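(* Let $G$ be an $n\times n$ grid with $n$ even. Every non-partitive initial configuration of $k\ge3$ robots on distinct nodes of $G$ in which all four corners of the minimum enclosing square are occupied is gatherable despite at most one crash fault.
   Context: Model. The grid is the anonymous grid graph. A configuration is $f:V(G)\to\{0,1,2\}$ ($0$ empty, $1$ singleton, $2$ multiplicity). Robots are anonymous, identical, oblivious, cannot communicate, share no coordinate system, orientation or chirality, run the same deterministic algorithm in Look–Compute–Move cycles (snapshot of the whole configuration with weak multiplicity detection; decision; instantaneous move to an adjacent node or stay), fully asynchronously (finite but unbounded adversarial delays; every non-crashed robot activated infinitely often). At most one robot may crash at an adversarial time (stops forever, stays visible, indistinguishable). Gatherable despite at most one crash fault: some such algorithm guarantees in every execution with at most one crash that after finite time all non-crashed robots are on one node and remain there. Partitive: some automorphism $\varphi$ of $(G,f)$ (graph automorphism with $f\circ\varphi=f$) of order $p>1$ has all orbits of $V(G)$ under $\langle\varphi\rangle$ of size exactly $p$. Minimum enclosing square: smallest square subgrid with the same geometric center as the grid containing all occupied nodes; its corners are its four corner nodes. *)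

(* Defs.v *)
(* Model of asynchronous, oblivious, disoriented robots on an
   n x n grid, with weak multiplicity detection and at most one crash fault. *)
From mathcomp Require Import all_boot all_order all_fingroup.
Set Implicit Arguments. Unset Strict Implicit. Unset Printing Implicit Defensive.

Section Grid.
Variable n : nat.

Definition node := ('I_n * 'I_n)%type.

Definition absdiff (a b : nat) : nat := (a - b) + (b - a).

Definition adj (u v : node) : bool :=
  absdiff u.1 v.1 + absdiff u.2 v.2 == 1.

Definition is_aut (s : {perm node}) : Prop :=
  forall u v : node, adj (s u) (s v) = adj u v.

Definition config := {ffun node -> 'I_3}.

Definition partitive (f : config) : Prop :=
  exists phi : {perm node},
    [/\ is_aut phi,
        (forall v, f (phi v) = f v),
        (1 < #[phi])%g &
        (forall v, #|porbit phi v| = #[phi]%g)].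

(* squares with the same geometric center as the grid: rows/cols in [a, n-1-a] *)
Definition in_square (a : nat) (v : node) : bool :=
  [&& a <= v.1, v.1 <= n.-1 - a, a <= v.2 & v.2 <= n.-1 - a].

Definition encloses (f : config) (a : nat) : bool :=
  (a.*2 < n) && [forall v : node, (f v != ord0) ==> in_square a v].

(* the minimum enclosing square is the one with the largest offset a *)
Definition mes_offset (f : config) : nat :=
  \max_(a : 'I_n | encloses f a) (a : nat).

Definition is_corner (a : nat) (v : node) : bool :=
  ((v.1 == a :> nat) || (v.1 == n.-1 - a :> nat)) &&
  ((v.2 == a :> nat) || (v.2 == n.-1 - a :> nat)).

Definition mes_corners_occupied (f : config) : Prop :=
  forall v : node, is_corner (mes_offset f) v -> f v != ord0.

Variable k : nat.

(* configuration induced by robot positions (weak multiplicity detection) *)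
Definition conf_of (pos : 'I_k -> node) : config :=
  [ffun v => inord (minn 2 #|[pred r | pos r == v]|)].

(* configuration as seen in the local frame sigma *)
Definition conf_map (s : {perm node}) (f : config) : config :=
  [ffun v => f ((s^-1)%g v)].

(* algorithm: (configuration, own position) |-> destination (in local frame) *)
Definition algorithm := config -> node -> node.

Definition valid_alg (A : algorithm) : Prop :=
  forall f v, A f v = v \/ adj v (A f v).

(* state: positions and pending destinations (a robot that has Looked but not yet Moved) *)
Record state := State { spos : 'I_k -> node; spend : 'I_k -> option node }.

Definition crashed (cr : option ('I_k * nat)) (t : nat) (r : 'I_k) : bool :=
  if cr is Some (c, tc) then (r == c) && (tc <= t) else false.

Definition never_crashed (cr : option ('I_k * nat)) (r : 'I_k) : Prop :=
  forall t, ~~ crashed cr t r.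

(* an activation token (r, sigma): robot r performs its next phase; if idle it
   Looks (with local frame sigma) and Computes its destination, if pending it Moves. *)
Definition step (A : algorithm) (cr : option ('I_k * nat)) (t : nat)
  (s : state) (tok : 'I_k * {perm node}) : state :=
  let: (r, sg) := tok in
  if crashed cr t r then s else
  match spend s r with
  | None =>
      let d := (sg^-1)%g (A (conf_map sg (conf_of (spos s))) (sg (spos s r))) in
      State (spos s) (fun r' => if r' == r then Some d else spend s r')
  | Some d =>
      State (fun r' => if r' == r then d else spos s r')
            (fun r' => if r' == r then None else spend s r')
  end.

Fixpoint exec (A : algorithm) (cr : option ('I_k * nat))
  (sched : nat -> 'I_k * {perm node}) (p0 : 'I_k -> node) (t : nat) : state :=
  match t with
  | 0 => State p0 (fun _ => None)
  | t'.+1 => step A cr t' (exec A cr sched p0 t') (sched t')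
  end.

Definition valid_sched (sched : nat -> 'I_k * {perm node}) : Prop :=
  forall t, is_aut (sched t).2.

Definition fair (cr : option ('I_k * nat)) (sched : nat -> 'I_k * {perm node}) : Prop :=
  forall r, never_crashed cr r -> forall t, exists2 t', t <= t' & (sched t').1 = r.

Definition gathers (A : algorithm) (cr : option ('I_k * nat))
  (sched : nat -> 'I_k * {perm node}) (p0 : 'I_k -> node) : Prop :=
  exists T (u : node), forall t, T <= t ->
    forall r, never_crashed cr r -> spos (exec A cr sched p0 t) r = u.

Definition gatherable_1crash (p0 : 'I_k -> node) : Prop :=
  exists A : algorithm, valid_alg A /\
    forall (cr : option ('I_k * nat)) (sched : nat -> 'I_k * {perm node}),
      valid_sched sched -> fair cr sched -> gathers A cr sched p0.

End Grid.

(* Main.v *)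
Require Import Defs.
From mathcomp Require Import all_boot all_order all_fingroup.
From mathcomp Require Import cyclic zify boolp.
Set Implicit Arguments. Unset Strict Implicit. Unset Printing Implicit Defensive.

(** Fix the enclosing square of the initial configuration and one of its corners
    [c]. Every move ever made is a _good_ one: a step closer to [c] inside the
    square that enters no other corner. Then as soon as [c] holds two robots it
    is forever the only corner with a multiplicity, and everybody can walk to it.
    Pending moves are harmless since all of them are good, and the total
    distance to [c] decreases, so it is enough that in every reachable
    configuration two robots are enabled and [c] can be recognized.

    Non-partitivity leaves either the trivial stabilizer or a single diagonal
    reflection.
    - Trivial stabilizer: let [(r, c)] be a closest pair of a non-corner robot and
      a corner. The enabled robots are [r] and the robot opposite to [c]. Once [r]
      has moved, [(r, c)] is the unique closest pair; once the opposite robot has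
      moved, [c] is the corner opposite to the only empty one, and all the
      non-corner robots, of which there are two, may go.
    - Diagonal reflection, with [c] and its opposite on the axis: the two corner
      robots off the axis leave first. An empty corner then reveals the axis, and
      [c] is the end of the axis with the nearer non-corner robot. In case of a
      tie [c] is chosen so that the first step of the side robots, taken next to
      their corners, tells it apart. The enabled robots are the closest ones to
      [c], the other side robot, and, when both side corners are empty, the robot
      opposite to [c]; after the latter has left, [c] is the only occupied corner. *)

(** * Equivariant move relations *)

Section Relation.
Variables (n k : nat) (M : config n -> node n -> node n -> Prop).

(** [M] may allow several moves. [pick] chooses one by an enumeration in local coordinates, so the
    choice can depend on the frame; equivariance is asked of [M] only. The default [v] makes a robot
    without an allowed move stay. *)
Definition alg_of : algorithm n :=
  fun f v => odflt v [pick w | `[< M f v w >]].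

Lemma alg_ofP f v :
  M f v (alg_of f v) \/ alg_of f v = v /\ forall w, ~ M f v w.
Proof.
rewrite /alg_of; case: pickP => [w /asboolP Mw|noM] /=; first by left.
by right; split=> // w Mw; move: (noM w); rewrite asboolT.
Qed.

Hypothesis M_adj : forall f v w, M f v w -> adj v w.
Hypothesis M_aut : forall g f v w, is_aut g ->
  M f v w -> M (conf_map g f) (g v) (g w).

Lemma is_autV (g : {perm node n}) : is_aut g -> is_aut (g^-1)%g.
Proof. by move=> ag u v; rewrite -ag !permKV. Qed.

Lemma conf_map_perm (g : {perm node n}) f v : conf_map g f (g v) = f v.
Proof. by rewrite ffunE permK. Qed.

Lemma conf_mapK (g : {perm node n}) f : conf_map (g^-1)%g (conf_map g f) = f.
Proof. by apply/ffunP => v; rewrite !ffunE invgK permK. Qed.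

Lemma conf_mapM (g h : {perm node n}) f :
  conf_map h (conf_map g f) = conf_map (g * h)%g f.
Proof. by apply/ffunP => v; rewrite !ffunE invMg permM. Qed.

Lemma adjxx (v : node n) : adj v v = false.
Proof. by rewrite /adj /absdiff !subnn. Qed.

Lemma alg_of_valid : valid_alg alg_of.
Proof.
by move=> f v; case: (alg_ofP f v) => [/M_adj|[-> _]]; [right|left].
Qed.

(** Equivariance carries the local choice back to the global frame: whatever frame the adversary
    supplies, the robot makes a move of [M], and it stays only where [M] allows nothing. *)
Lemma alg_of_frame (g : {perm node n}) f v (d := (g^-1)%g (alg_of (conf_map g f) (g v))) :
  is_aut g -> M f v d \/ d = v /\ forall w, ~ M f v w.
Proof.
move=> ag; rewrite /d; case: (alg_ofP (conf_map g f) (g v)) => [Mw|[-> noM]].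
  by left; have := M_aut (is_autV ag) Mw; rewrite conf_mapK permK.
by right; rewrite permK; split=> // w /(M_aut ag)/noM.
Qed.

Variables (p0 : 'I_k -> node n) (c : node n) (phi : node n -> nat).
(** Pending destinations belong to the invariant, since a move may be executed long after it was
    decided. In [no_deadlock], [z] is the robot that may crash. *)
Variable Inv : ('I_k -> node n) -> ('I_k -> option (node n)) -> Prop.
Hypothesis Inv0 : Inv p0 (fun _ => None).
Hypothesis Inv_look : forall P Q r w, Inv P Q -> Q r = None ->
  M (conf_of P) (P r) w \/ w = P r ->
  Inv P (fun r' => if r' == r then Some w else Q r').
Hypothesis Inv_move : forall P Q r w, Inv P Q -> Q r = Some w ->
  Inv (fun r' => if r' == r then w else P r')
      (fun r' => if r' == r then None else Q r').
Hypothesis phi_move : forall P Q r w, Inv P Q -> Q r = Some w ->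
  w = P r \/ phi w < phi (P r).
Hypothesis no_deadlock : forall P Q (z : option 'I_k), Inv P Q ->
  (forall r, Some r != z -> forall w, ~ M (conf_of P) (P r) w) ->
  forall r, Some r != z -> P r = c.

(** * Runs under a fixed crash and a fixed schedule *)

Section Run.
Variables (cr : option ('I_k * nat)) (sched : nat -> 'I_k * {perm node n}).
Hypothesis vs : valid_sched sched.
Let E := exec alg_of cr sched p0.

Lemma exec_Inv t : Inv (spos (E t)) (spend (E t)).
Proof.
elim: t => [//|t IH]; rewrite /E /= -/E /step.
case: (sched t) (vs t) => r sg /= asg.
case: ifP => // _; case Er: (spend (E t) r) => [d|] /=; first exact: Inv_move.
apply: Inv_look => //.
by case: (alg_of_frame (conf_of (spos (E t))) (spos (E t) r) asg) => [|[]]; [left|right].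
Qed.

Let Phi t := \sum_r phi (spos (E t) r).

Lemma exec_pos_step t :
  Phi t.+1 <= Phi t /\
  (Phi t.+1 = Phi t -> forall r, spos (E t.+1) r = spos (E t) r).
Proof.
have := exec_Inv t; rewrite /Phi /E /= -/E /step.
case: (sched t) => r sg /= I; case: ifP => // _.
case Er: (spend (E t) r) => [d|] //=.
case: (phi_move I Er) => [dE|lt_d].
  have posE r' : (if r' == r then d else spos (E t) r') = spos (E t) r'.
    by case: eqP => // ->.
  by split=> //; apply: eq_leq; apply: eq_bigr => i _; rewrite posE.
have lt : \sum_r0 phi (if r0 == r then d else spos (E t) r0)
            < \sum_r0 phi (spos (E t) r0).
  rewrite (bigD1 r) //= [X in _ < X](bigD1 r) //= eqxx.
  rewrite -addSn leq_add //; apply: eq_leq.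
  by apply: eq_bigr => i /negPf ->.
by split; [exact: ltnW | move=> eq; move: lt; rewrite eq ltnn].
Qed.

(** The sum of [phi] over the robots never increases, and a step that keeps it moves nobody; so the
    positions freeze once the sum has reached its least value. *)
Lemma exec_pos_const : exists T, forall t, T <= t ->
  forall r, spos (E t) r = spos (E T) r.
Proof.
have [T minT] : exists T, forall t, Phi T <= Phi t.
  have ex : exists s, `[< exists t, Phi t = s >] by exists (Phi 0); apply/asboolP; exists 0.
  case: (ex_minnP ex) => s /asboolP[T TE] mins; exists T => t.
  by rewrite TE; apply: mins; apply/asboolP; exists t.
exists T => t /subnK <-; elim: (t - T) => [//|j IH] r.
rewrite addSn; have [le_j eq_j] := exec_pos_step (j + T).
rewrite eq_j ?IH //; apply/eqP; rewrite eqn_leq le_j /=.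
rewrite (leq_trans _ (minT _)) //.
by apply: eq_leq; apply: eq_bigr => i _; rewrite IH.
Qed.

Hypothesis fs : fair cr sched.

(** The witness is the first activation of [r] from time [t] on; steps of other robots do not touch
    what [r] has pending. *)
Lemma next_activation r t : never_crashed cr r ->
  exists t', [/\ t <= t', (sched t').1 = r & spend (E t') r = spend (E t) r].
Proof.
move=> nc.
have ex : exists j, (sched (t + j)).1 == r.
  by have [t' le_t <-] := fs nc t; exists (t' - t); rewrite subnKC.
case: (ex_minnP ex) => j /eqP jr minj; exists (t + j); rewrite leq_addr jr; split=> //.
have : forall i, i <= j -> spend (E (t + i)) r = spend (E t) r.
  elim=> [|i IH] lt_i; first by rewrite addn0.
  rewrite addnS -IH ?(ltnW lt_i) // /E /= -/E /step.
  case Es: (sched (t + i)) => [q sg].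
  have neq : (r == q) = false.
    apply/negP => /eqP rq; have := minj i; rewrite Es rq eqxx => /(_ isT).
    by rewrite leqNgt lt_i.
  by case: ifP => // _; case: (spend (E (t + i)) q) => [d|] /=; rewrite neq.
exact.
Qed.

(** The robot completes a whole cycle after time [T]. If [M] allowed it a move, the cycle would take
    it to an adjacent, hence different, node, although the positions are frozen. *)
Lemma exec_disabled T r : never_crashed cr r ->
  (forall t, T <= t -> forall r, spos (E t) r = spos (E T) r) ->
  forall w, ~ M (conf_of (spos (E T))) (spos (E T) r) w.
Proof.
move=> nc const.
have confE t : T <= t -> conf_of (spos (E t)) = conf_of (spos (E T)).
  move=> le_t; apply/ffunP => v; rewrite !ffunE; congr (inord (minn 2 _)).
  by apply: eq_card => q; rewrite !inE const.
have from_idle t : T <= t -> spend (E t) r = None ->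
    forall w, ~ M (conf_of (spos (E T))) (spos (E T) r) w.
  (* The robot looks at time [t1] and moves at time [t2]. *)
  move=> le_t idle; have [t1 [le1 s1 p1]] := next_activation t nc.
  have [t2 [le2 s2 p2]] := next_activation t1.+1 nc.
  have leT1 : T <= t1 by exact: leq_trans le_t le1.
  have := vs t1; have := const t2.+1; have := p2.
  rewrite /E /= -/E /step.
  case Es1: (sched t1) s1 => [q sg] /= ->; rewrite (negPf (nc _)) p1 idle /= eqxx.
  case: (sched t2) s2 => q2 sg2 /= -> p2'; rewrite (negPf (nc _)) p2' /=.
  have leT2 : T <= t2.+1 by move: leT1 le2; lia.
  move=> /(_ leT2 r); rewrite eqxx (confE _ leT1) (const _ leT1) => dE asg w.
  case: (alg_of_frame (conf_of (spos (E T))) (spos (E T) r) asg) => [|[_ noM]].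
    by rewrite dE => /M_adj; rewrite adjxx.
  exact: noM.
(* A destination already pending at time [T] is used up first; afterwards the robot is idle. *)
have [t1 [le1 s1 p1]] := next_activation T nc.
case pT: (spend (E T) r) p1 => [d|] p1; last exact: (from_idle T).
apply: (from_idle t1.+1); first exact: leqW.
rewrite /E /= -/E /step; case: (sched t1) s1 => q sg /= ->.
by rewrite (negPf (nc _)) p1 /= eqxx.
Qed.

Lemma exec_gathers : gathers alg_of cr sched p0.
Proof.
have [T const] := exec_pos_const.
exists T, c => t le_t r nc; rewrite -/E const //.
pose z := omap fst cr.
have ncP q : Some q != z -> never_crashed cr q.
  rewrite /z; case: cr => [[z' tz]|] //= qz t'; rewrite /crashed.
  by apply: contra qz => /andP[/eqP->].
apply: (no_deadlock (z := z) (exec_Inv T)).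
  by move=> q /ncP ncq; apply: exec_disabled.
rewrite /z; case: cr nc => [[z' tz]|] //= /(_ tz); rewrite /crashed leqnn andbT.
by apply: contra => /eqP[->].
Qed.

End Run.

Lemma gatherable_of_relation : gatherable_1crash p0.
Proof.
exists alg_of; split; first exact: alg_of_valid.
by move=> cr sched vs fs; apply: exec_gathers.
Qed.

End Relation.

(** * Automorphisms of the grid *)

Section Automorphisms.
Variable n : nat.

(* A label names one of the four corners of the grid, or of a centered square:
   [true] in a coordinate selects the end at which that coordinate is large. *)
Definition label := (bool * bool)%type.

Definition opp (b : label) : label := (~~ b.1, ~~ b.2).

Lemma oppK : involutive opp.
Proof. by move=> [[] []]. Qed.

Lemma opp_neq b : (opp b == b) = false.
Proof. by case: b => [[] []]. Qed.

Definition flip (b : bool) (i : 'I_n) : 'I_n := if b then rev_ord i else i.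

Lemma flipE b i : flip b i = (if b then n.-1 - i else i) :> nat.
Proof. by case: b => //=; lia. Qed.

Lemma flip_add b c i : flip (c (+) b) (flip c i) = flip b i.
Proof. by case: b c => [] [] //=; rewrite rev_ordK. Qed.

(** Coordinates measured from the corner of the grid named by [b]; their sum [dl] is the graph
    distance to that corner. *)
Definition rx (b : label) (v : node n) : nat := flip b.1 v.1.
Definition ry (b : label) (v : node n) : nat := flip b.2 v.2.
Definition dl (b : label) (v : node n) : nat := rx b v + ry b v.
Definition at_label (b : label) (i j : 'I_n) : node n := (flip b.1 i, flip b.2 j).

(** The eight symmetries of the square: [s] tells whether the coordinates are exchanged, [c] which
    of them are then reversed. [dihedral_label] is the induced action on corners. *)
Definition dihedral (s : bool) (c : label) (v : node n) : node n :=
  if s then (flip c.1 v.2, flip c.2 v.1) else (flip c.1 v.1, flip c.2 v.2).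

Definition dihedral_label (s : bool) (c b : label) : label :=
  if s then (c.1 (+) b.2, c.2 (+) b.1) else (c.1 (+) b.1, c.2 (+) b.2).

Definition dist (u v : node n) := absdiff u.1 v.1 + absdiff u.2 v.2.

Lemma node_eq (u v : node n) : u.1 = v.1 :> nat -> u.2 = v.2 :> nat -> u = v.
Proof. by case: u v => [u1 u2] [v1 v2] /= /val_inj -> /val_inj ->. Qed.

Lemma rxE b v : rx b v = if b.1 then n.-1 - v.1 else v.1.
Proof. exact: flipE. Qed.

Lemma ryE b v : ry b v = if b.2 then n.-1 - v.2 else v.2.
Proof. exact: flipE. Qed.

Lemma dist_ind_step (u v : node n) : 0 < dist u v ->
  exists2 w, adj u w & dist u v = (dist w v).+1.
Proof.
case: u v => [u1 u2] [v1 v2]; rewrite /dist /adj /absdiff /= => pos.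
have [lt|le] := ltnP u1 v1.
  have lt1 : u1.+1 < n by have := ltn_ord v1; lia.
  by exists (Ordinal lt1, u2) => /=; lia.
have [lt|le'] := ltnP v1 u1.
  have lt1 : u1.-1 < n by have := ltn_ord u1; lia.
  by exists (Ordinal lt1, u2) => /=; lia.
have [lt|le''] := ltnP u2 v2.
  have lt1 : u2.+1 < n by have := ltn_ord v2; lia.
  by exists (u1, Ordinal lt1) => /=; lia.
have lt1 : u2.-1 < n by have := ltn_ord u2; lia.
by exists (u1, Ordinal lt1) => /=; lia.
Qed.

Lemma dist_triangle (u v w : node n) : dist u w <= dist u v + dist v w.
Proof. by rewrite /dist /absdiff; lia. Qed.

Lemma aut_dist_le (g : {perm node n}) u v : is_aut g -> dist (g u) (g v) <= dist u v.
Proof.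
move=> ag; move dE: (dist u v) => d; elim: d u dE => [|d IH] u dE.
  suff -> : u = v by rewrite /dist /absdiff !subnn.
  by apply: node_eq; move: dE; rewrite /dist /absdiff; lia.
have [|w uw wE] := @dist_ind_step u v; first by rewrite dE.
apply: leq_trans (dist_triangle _ (g w) _) _.
have -> : dist (g u) (g w) = 1 by move: uw; rewrite -ag => /eqP.
by rewrite add1n ltnS; apply: IH; move: wE; rewrite dE => -[].
Qed.

Lemma aut_dist (g : {perm node n}) u v : is_aut g -> dist (g u) (g v) = dist u v.
Proof.
move=> ag; apply/eqP; rewrite eqn_leq aut_dist_le //=.
by have := aut_dist_le (g u) (g v) (is_autV ag); rewrite !permK.
Qed.

(** Automorphisms preserve [dist], and only opposite corners of the grid are at distance 2(n - 1).
    So corners go to corners, and a node is determined by its distances to two adjacent ones. *)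
Lemma dihedral_aut (g : {perm node n}) : 1 < n -> is_aut g ->
  exists s c, forall v, g v = dihedral s c v.
Proof.
move=> n_gt1 ag; have n_gt0 : 0 < n by exact: ltnW.
pose i0 : 'I_n := Ordinal n_gt0.
pose gc b := at_label b i0 i0.
have D u v := aut_dist u v ag.
have far u v : dist u v = n.-1.*2 -> exists b, u = gc b /\ v = gc (opp b).
  move=> far_uv.
  exists (0 < u.1, 0 < u.2).
  move: far_uv (ltn_ord u.1) (ltn_ord u.2) (ltn_ord v.1) (ltn_ord v.2).
  rewrite /dist /absdiff => ? ? ? ? ?.
  by case: (ltnP 0 u.1) => ?; case: (ltnP 0 u.2) => ?;
    split; apply: node_eq => /=; lia.
have far_opp b : dist (gc b) (gc (opp b)) = n.-1.*2.
  by rewrite /dist /absdiff; case: b => [[] []] /=; lia.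
have [c [c00 c11]] : exists b, g (gc (false, false)) = gc b /\ g (gc (opp (false, false))) = gc (opp b).
  by apply: far; rewrite D far_opp.
have [e [e10 e01]] : exists b, g (gc (true, false)) = gc b /\ g (gc (opp (true, false))) = gc (opp b).
  by apply: far; rewrite D far_opp.
have gcE b v : dist v (gc b) = dl b v.
  move: (ltn_ord v.1) (ltn_ord v.2); rewrite /dl rxE ryE /dist /absdiff /gc; clear.
  by case: b => [[] []] /=; lia.
have d1 : dl e (gc c) = n.-1.
  by rewrite -gcE -c00 -e10 D gcE /dl rxE ryE /=; lia.
(* The two chosen corners differ in the first coordinate; their images agree in it exactly when the
   coordinates are exchanged. *)
exists (c.1 == e.1), c => v.
have := D v (gc (false, false)); have := D v (gc (true, false)).
rewrite c00 e10 !gcE /dl !rxE !ryE /=.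
move: d1 (ltn_ord v.1) (ltn_ord v.2) (ltn_ord (g v).1) (ltn_ord (g v).2).
rewrite /dl !rxE !ryE; clear -n_gt1.
by case: c => [[] []]; case: e => [[] []] //= *; try lia; apply: node_eq => /=; lia.
Qed.

Lemma dihedral_at s c b i j : dihedral s c (at_label b i j) =
  at_label (dihedral_label s c b) (if s then j else i) (if s then i else j).
Proof.
by case: s c b => [] [[] []] [[] []]; rewrite /dihedral /at_label /= ?rev_ordK.
Qed.

Lemma rx_dihedral s c b v :
  rx (dihedral_label s c b) (dihedral s c v) = if s then ry b v else rx b v.
Proof. by case: s; rewrite /rx /ry /= flip_add. Qed.

Lemma ry_dihedral s c b v :
  ry (dihedral_label s c b) (dihedral s c v) = if s then rx b v else ry b v.
Proof. by case: s; rewrite /rx /ry /= flip_add. Qed.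

Lemma dl_dihedral s c b v : dl (dihedral_label s c b) (dihedral s c v) = dl b v.
Proof. by rewrite /dl rx_dihedral ry_dihedral; case: s => //; rewrite addnC. Qed.

Lemma dihedral_label_bij s c : bijective (dihedral_label s c).
Proof.
exists (fun b => if s then (c.2 (+) b.2, c.1 (+) b.1) else dihedral_label s c b);
by case: s c => [] [[] []] [[] []].
Qed.

Lemma dihedral_label_opp s c b : dihedral_label s c (opp b) = opp (dihedral_label s c b).
Proof. by case: s c b => [] [[] []] [[] []]. Qed.

Lemma dihedral_is_aut s c (g : {perm node n}) : (forall v, g v = dihedral s c v) -> is_aut g.
Proof.
move=> gE u v; rewrite !gE /adj /absdiff.
have := ltn_ord u.1; have := ltn_ord u.2; have := ltn_ord v.1; have := ltn_ord v.2.
by case: s c {gE} => [] [[] []] /=; lia.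
Qed.

Lemma dihedral_inj s c : injective (dihedral s c).
Proof.
have flip_inj b : injective (flip b) by case: b => //; exact: rev_ord_inj.
by case: s => [] [u1 u2] [v1 v2] [] /flip_inj /= -> /flip_inj /= ->.
Qed.

End Automorphisms.

(** All orbits of a fixed-point-free involution have two elements. *)
Lemma involution_partitive n (f : config n) (s : {perm node n}) :
  0 < n -> is_aut s -> (forall v, f (s v) = f v) ->
  (forall v, s (s v) = v) -> (forall v, s v != v) -> partitive f.
Proof.
move=> n_gt0 as_ fs ss sfix.
have sE : #[s]%g = 2.
  apply: nt_prime_order => //.
    by apply/permP => v; rewrite expgS expg1 permM ss perm1.
  apply/eqP => /permP /(_ (Ordinal n_gt0, Ordinal n_gt0)).
  by rewrite perm1; apply/eqP.
exists s; split=> //; first by rewrite sE.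
move=> v; rewrite sE.
suff -> : porbit s v = [set v; s v] by rewrite cards2 eq_sym sfix.
apply/setP => u; rewrite !inE; apply/porbitP/orP => [[i ->]|[/eqP->|/eqP->]].
- elim: i => [|i [/eqP IH|/eqP IH]]; first by left; rewrite expg0 perm1.
  + by right; rewrite expgSr permM IH.
  + by left; rewrite expgSr permM IH ss.
- by exists 0; rewrite expg0 perm1.
- by exists 1; rewrite expg1.
Qed.

(** * The enclosing square *)

Section Square.
Variables (n : nat) (a : 'I_n).
(** The square has side n - 2a, which is thus at least 4: the neighbours of its corners are not
    corners. *)
Hypothesis a_lt : a.*2.+3 < n.

Fact succ_a_lt : a.+1 < n.
Proof. by move: a_lt; lia. Qed.

Let a1 := Ordinal succ_a_lt.

Let a1E : a1 = a.+1 :> nat.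
Proof. by []. Qed.

Definition cor (b : label) : node n := at_label b a a.

(* The neighbour of [cor z] in the direction of [b], when [z] and [b] are
   adjacent corners. *)
Definition exit (z b : label) : node n :=
  at_label z (if z.1 == b.1 then a else a1) (if z.2 == b.2 then a else a1).

(** Inside the square the distance [dl b] to the corner of the grid exceeds the distance to [cor b]
    by the constant 2a, so either one can measure progress. *)
Definition good (b : label) (v w : node n) : bool :=
  [&& adj v w, dl b w < dl b v, in_square a w & (w == cor b) || ~~ is_corner a w].

Lemma node_rel b (u v : node n) : rx b u = rx b v -> ry b u = ry b v -> u = v.
Proof.
rewrite !rxE !ryE => e1 e2; apply: node_eq; move: e1 e2;
have := ltn_ord u.1; have := ltn_ord u.2; have := ltn_ord v.1; have := ltn_ord v.2;
by case: b => [[] []] /=; lia.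
Qed.

Lemma rel_bound b (v : node n) : rx b v < n /\ ry b v < n.
Proof. by rewrite /rx /ry !ltn_ord. Qed.

Lemma squareE b (v : node n) :
  in_square a v = [&& a <= rx b v, rx b v <= n.-1 - a, a <= ry b v & ry b v <= n.-1 - a].
Proof.
rewrite rxE ryE /in_square; have := ltn_ord v.1; have := ltn_ord v.2.
by case: b => [[] []] /=; lia.
Qed.

Lemma cornerE b (v : node n) : is_corner a v =
  ((rx b v == a) || (rx b v == n.-1 - a)) && ((ry b v == a) || (ry b v == n.-1 - a)).
Proof.
rewrite rxE ryE /is_corner; have := ltn_ord v.1; have := ltn_ord v.2.
by case: b => [[] []] /=; lia.
Qed.

Lemma adjE b (u v : node n) : adj u v =
  (absdiff (rx b u) (rx b v) + absdiff (ry b u) (ry b v) == 1).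
Proof.
have flip_absdiff c (i j : 'I_n) : absdiff (flip c i) (flip c j) = absdiff i j.
  have := ltn_ord i; have := ltn_ord j; rewrite /absdiff; clear.
  by case: c => /=; lia.
by rewrite /rx /ry !flip_absdiff.
Qed.

Lemma cor_coord b z :
  rx b (cor z) = (if z.1 == b.1 then a : nat else n.-1 - a) /\
  ry b (cor z) = (if z.2 == b.2 then a : nat else n.-1 - a).
Proof.
rewrite rxE ryE /cor /=; have := ltn_ord a.
by case: b z => [[] []] [[] []] /=; lia.
Qed.

Lemma cor_rel b v : rx b v = a -> ry b v = a -> v = cor b.
Proof.
by have := cor_coord b b; rewrite !eqxx => -[ex ey] vx vy; apply: (@node_rel b); lia.
Qed.

Lemma exit_coord b z : [/\ rx z (exit z b) = (if z.1 == b.1 then a : nat else a1) &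
  ry z (exit z b) = (if z.2 == b.2 then a : nat else a1)].
Proof.
rewrite rxE ryE /exit /=; have := ltn_ord a; have := ltn_ord a1.
by case: b z => [[] []] [[] []] /=; lia.
Qed.

Lemma dl_opp b (v : node n) : dl b v + dl (opp b) v = n.-1.*2.
Proof.
rewrite /dl !rxE !ryE; have := ltn_ord v.1; have := ltn_ord v.2.
by case: b => [[] []] /=; lia.
Qed.

Lemma cor_inj : injective cor.
Proof.
move=> b z /(congr1 (fun v => (rx b v, ry b v))) [].
have [-> ->] := cor_coord b b; have [-> ->] := cor_coord b z; rewrite !eqxx.
by move: a_lt; clear; case: b z => [[] []] [[] []] //=; lia.
Qed.

Lemma is_cornerP v : reflect (exists b, v = cor b) (is_corner a v).
Proof.
apply: (iffP idP) => [|[b ->]]; last first.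
  rewrite (cornerE b); have [-> ->] := cor_coord b b.
  by rewrite !eqxx.
rewrite /is_corner => /andP[x y].
exists (v.1 != a :> nat, v.2 != a :> nat); move: x y (ltn_ord a).
by case: (v.1 =P a :> nat) => /= h1; case: (v.2 =P a :> nat) => /= h2 *;
  apply: node_eq => /=; lia.
Qed.

Lemma cor_corner b : is_corner a (cor b).
Proof. by apply/is_cornerP; exists b. Qed.

Lemma good_coord b v w : good b v w ->
  [/\ dl b v = (dl b w).+1, rx b w <= rx b v, ry b w <= ry b v & in_square a w].
Proof.
rewrite /good => /and4P[]; rewrite (adjE b) /dl /absdiff => vw lt -> _.
by split=> //; move: vw lt; lia.
Qed.

Lemma good_dl_opp b v w : good b v w -> dl (opp b) w = (dl (opp b) v).+1.
Proof.
by move=> /good_coord[lt _ _ _]; have := dl_opp b v; have := dl_opp b w; lia.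
Qed.

Lemma good_corner b z v : good b v (cor z) -> z = b.
Proof. by case/and4P=> _ _ _; rewrite cor_corner orbF => /eqP/cor_inj. Qed.

Lemma good_target b w : ~~ good b (cor b) w.
Proof.
apply/negP => /good_coord[]; rewrite (squareE b) /dl.
by have [-> ->] := cor_coord b b; rewrite !eqxx; lia.
Qed.

(** Decrease the larger of the two coordinates. If it drops to [a], the other one is at most a + 1,
    which is less than n - 1 - a; so no corner but [cor b] is entered. *)
Lemma good_exists b v : in_square a v -> v != cor b -> exists w, good b v w.
Proof.
rewrite (squareE b) => sq neq.
have mk x y : x < n -> y < n -> exists w : node n, rx b w = x /\ ry b w = y.
  move=> lx ly; exists (at_label b (Ordinal lx) (Ordinal ly)).
  by rewrite rxE ryE /=; case: b {sq neq} => [[] []] /=; lia.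
have [bx by_] := rel_bound b v.
have ne : ~ (rx b v = a /\ ry b v = a).
  by move=> [ex ey]; case/eqP: neq; apply: cor_rel.
have [le|lt] := leqP (ry b v) (rx b v).
  have [w [wx wy]] := mk (rx b v).-1 (ry b v) ltac:(lia) by_.
  exists w; rewrite /good (adjE b) (squareE b) (cornerE b) /dl wx wy /absdiff.
  have [/andP[/eqP e1 /eqP e2]|nc] := boolP ((rx b w == a) && (ry b w == a)).
    have -> : w = cor b by exact: cor_rel.
    by move: e1 e2 ne sq le; rewrite eqxx wx wy; clear; lia.
  by rewrite wx wy in nc; move: nc sq le ne a_lt; clear; lia.
have [w [wx wy]] := mk (rx b v) (ry b v).-1 bx ltac:(lia).
exists w; rewrite /good (adjE b) (squareE b) (cornerE b) /dl wx wy /absdiff.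
have [/andP[/eqP e1 /eqP e2]|nc] := boolP ((rx b w == a) && (ry b w == a)).
  have -> : w = cor b by exact: cor_rel.
  by move: e1 e2 ne sq lt; rewrite eqxx wx wy; clear; lia.
by rewrite wx wy in nc; move: nc sq lt ne a_lt; clear; lia.
Qed.

(** A corner adjacent to [cor b] is at distance n - 1 from both [b] and [opp b]; its exit is one
    step away from this tie. *)
Lemma dl_exit b z : z != b -> z != opp b ->
  dl b (exit z b) = n.-2 /\ dl (opp b) (exit z b) = n.
Proof.
have := dl_opp b (exit z b).
rewrite /dl !rxE !ryE /exit; have := ltn_ord a; have := ltn_ord a1.
by move: a1E a_lt; clear; case: b z => [[] []] [[] []] //=; lia.
Qed.

Lemma exit_corner b z : z != b -> z != opp b -> ~~ is_corner a (exit z b).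
Proof.
rewrite (cornerE z); have [-> ->] := exit_coord b z.
by move: a1E a_lt; clear; case: b z => [[] []] [[] []] //=; lia.
Qed.

(** Only one of the two neighbours of [cor z] in the square is closer to [b], so the first step of
    such a corner robot is forced. *)
Lemma good_exit b z w : z != b -> z != opp b -> good b (cor z) w -> w = exit z b.
Proof.
move=> zb zo /and4P[+ + + _]; rewrite (adjE b) (squareE b) /dl /absdiff.
have [-> ->] := cor_coord b z => adjw lt sq.
have [ex ey] := exit_coord b z.
apply: (@node_rel z); rewrite ?ex ?ey a1E; move: adjw lt sq {ex ey}; rewrite !rxE !ryE.
all: have := ltn_ord w.1; have := ltn_ord w.2.
all: by move: zb zo a_lt; clear; case: b z => [[] []] [[] []] //=; lia.
Qed.

(* For adjacent [z] and [b], the other neighbour of [cor z] is [exit z (opp b)]: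
   no exit towards [b] falls on it. *)
Lemma exit_neq b z y : z != b -> z != opp b -> y != b -> y != opp b ->
  exit y b != exit z (opp b).
Proof.
move=> h1 h2 h3 h4; apply/eqP => /(congr1 (fun v : node n => (v.1 : nat, v.2 : nat))) [].
rewrite !flipE; move: h1 h2 h3 h4 a1E a_lt; clear.
by case: b z y => [[] []] [[] []] [[] []] //=; lia.
Qed.

(** The equivariance of both move rules rests on this: an automorphism permutes the labels and
    carries along every notion built from them. *)
Lemma aut_labels g : is_aut g -> exists gl : label -> label,
  [/\ bijective gl, forall b, gl (opp b) = opp (gl b),
      forall b, g (cor b) = cor (gl b), forall z b, g (exit z b) = exit (gl z) (gl b) &
      forall b v, dl (gl b) (g v) = dl b v] /\
  [/\ forall v, in_square a (g v) = in_square a v,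
      forall v, is_corner a (g v) = is_corner a v &
      forall b v w, good (gl b) (g v) (g w) = good b v w].
Proof.
move=> ag; have [|s [c gE]] := dihedral_aut _ ag; first by have := ltn_ord a1; lia.
have sqE v : in_square a (g v) = in_square a v.
  rewrite gE (squareE (dihedral_label s c (false, false))) rx_dihedral ry_dihedral.
  by rewrite (squareE (false, false)); case: s {gE}; lia.
have cE v : is_corner a (g v) = is_corner a v.
  rewrite gE (cornerE (dihedral_label s c (false, false))) rx_dihedral ry_dihedral.
  by rewrite (cornerE (false, false)); case: s {gE}; lia.
have corE b : g (cor b) = cor (dihedral_label s c b).
  by rewrite gE /cor dihedral_at; case: s {gE}.
have dlE b v : dl (dihedral_label s c b) (g v) = dl b v by rewrite gE dl_dihedral.
exists (dihedral_label s c); split; split=> //.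
- exact: dihedral_label_bij.
- exact: dihedral_label_opp.
- move=> z b; rewrite gE /exit dihedral_at.
  by case: s c {gE cE corE dlE sqE} => [] [[] []]; case: z b => [[] []] [[] []].
- by move=> b v w; rewrite /good ag !dlE sqE cE -corE (inj_eq perm_inj).
Qed.

End Square.

(** * Configurations of travelling robots *)

Section Conf.
Variables (n k : nat) (P : 'I_k -> node n).

Lemma conf_val v : conf_of P v = minn 2 #|[pred r | P r == v]| :> nat.
Proof. by rewrite ffunE inordK // ltnS geq_minl. Qed.

Lemma conf_zero v : (forall r, P r <> v) -> conf_of P v = 0 :> nat.
Proof.
move=> h; rewrite conf_val (_ : #|_| = 0) //.
by apply: eq_card0 => r; rewrite !inE; apply/eqP.
Qed.

Lemma conf_occ q : conf_of P (P q) != ord0.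
Proof.
rewrite -val_eqE /= conf_val -lt0n leq_min /=.
by apply/card_gt0P; exists q; rewrite !inE.
Qed.

Lemma conf_occP v : reflect (exists q, P q = v) (conf_of P v != ord0).
Proof.
apply: (iffP idP) => [|[q <-]]; last exact: conf_occ.
move=> occ; apply: contrapT => /forallNP nex; case/negP: occ.
by rewrite -val_eqE /= conf_zero.
Qed.

Lemma conf_le1 v : (forall q r, P q = v -> P r = v -> q = r) -> conf_of P v <= 1.
Proof.
move=> h; rewrite conf_val geq_min orbC; apply/orP; left.
rewrite leqNgt; apply/negP => /card_gt1P[q [r [+ +]]]; rewrite !inE => /eqP qv /eqP rv.
by case/eqP; apply: h.
Qed.

Lemma conf_one q : (forall r, P r = P q -> r = q) -> conf_of P (P q) = 1 :> nat.
Proof.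
move=> h; apply/eqP; rewrite eqn_leq lt0n; apply/andP; split; last exact: conf_occ.
by apply: conf_le1 => r s /h-> /h->.
Qed.

Lemma conf_two q r v : q != r -> P q = v -> P r = v -> conf_of P v = 2 :> nat.
Proof.
move=> qr qv rv; rewrite conf_val; apply/minn_idPl/card_gt1P.
by exists q, r; rewrite !inE qv rv eqxx; split.
Qed.

End Conf.

Lemma upd_same T (k : nat) (P : 'I_k -> T) r : (fun r' => if r' == r then P r else P r') = P.
Proof. by apply: funext => q; case: eqP => // ->. Qed.

(** * Invariants common to both protocols *)

Section Travel.
Variables (n k : nat) (a : 'I_n).
Hypothesis a_lt : a.*2.+3 < n.
Variables (p0 : 'I_k -> node n) (R : label -> 'I_k) (b0 : label).
Hypothesis p0_inj : injective p0.
Hypothesis p0R : forall z, p0 (R z) = @cor n a z.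
Hypothesis p0_sq : forall q, in_square a (p0 q).

Local Notation cor := (cor a).
Local Notation good := (good a).
Implicit Types (P : 'I_k -> node n) (Q : 'I_k -> option (node n)).

Lemma R_inj : injective R.
Proof. by move=> y z yz; apply: (cor_inj a_lt); rewrite -!p0R yz. Qed.

Lemma p0_corner z q : p0 q = cor z -> q = R z.
Proof. by rewrite -p0R => /p0_inj. Qed.

Lemma p0_nonR q z : ~~ is_corner a (p0 q) -> q != R z.
Proof. by apply: contra => /eqP->; rewrite p0R cor_corner. Qed.

Lemma conf0_corner z : conf_of p0 (cor z) = 1 :> nat.
Proof. by rewrite -p0R conf_one // => r /p0_inj. Qed.

Lemma conf_map0_corner g z : is_aut g -> conf_map g (conf_of p0) (cor z) = 1 :> nat.
Proof.
move=> ag; have [gl [[[gi _ giK] _ corE _ _] _]] := aut_labels a_lt ag.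
by rewrite -(giK z) -corE conf_map_perm conf0_corner.
Qed.

(** No good move enters a corner other than the target, so such a corner can only hold the robot
    [R z] that started there. *)
Definition travelling P Q :=
  [/\ forall q, in_square a (P q),
      forall q w, Q q = Some w -> w = P q \/ good b0 (P q) w,
      P (R b0) = cor b0 &
      forall z q, z != b0 -> P q = cor z -> q = R z].

Lemma travelling0 : travelling p0 (fun _ => None).
Proof. by split=> // z q _; apply: p0_corner. Qed.

Lemma travelling_look P Q r w : travelling P Q -> w = P r \/ good b0 (P r) w ->
  travelling P (fun r' => if r' == r then Some w else Q r').
Proof.
by case=> sq pend tgt out ok; split=> // q w'; case: eqP => [->[<-]|_ /pend].
Qed.

Lemma travelling_move P Q r w : travelling P Q -> Q r = Some w ->
  travelling (fun r' => if r' == r then w else P r')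
             (fun r' => if r' == r then None else Q r').
Proof.
case=> sq pend tgt out Qr; split.
- move=> q; case: eqP => // _; case: (pend _ _ Qr) => [->//|/(good_coord a_lt)[]//].
- by move=> q w'; case: eqP => // _ /pend.
- case: eqP => // Rr; case: (pend _ _ Qr); rewrite -Rr tgt // => G.
  by move: (good_target a_lt b0 w); rewrite G.
- move=> z q zb; case: eqP => [->|_]; last exact: out.
  move=> wz; case: (pend _ _ Qr) => [wE|]; first by apply: out; rewrite // -wE.
  by rewrite wz => /(good_corner a_lt) zE; move: zb; rewrite zE ?eqxx.
Qed.

Lemma travelling_dl P Q r w : travelling P Q -> Q r = Some w ->
  w = P r \/ dl b0 w < dl b0 (P r).
Proof.
by case=> _ pend _ _ /pend [->|/(good_coord a_lt)[->]]; [left | right].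
Qed.

Definition multiple P := exists2 q, q != R b0 & P q = cor b0.

Lemma multiple_upd P Q r w : travelling P Q -> Q r = Some w -> multiple P ->
  multiple (fun r' => if r' == r then w else P r').
Proof.
case=> _ pend _ _ /pend ok [q qR qb]; exists q => //; case: eqP => // qr.
case: ok; rewrite -qr qb // => G; by move: (good_target a_lt b0 w); rewrite G.
Qed.

Lemma conf_target_multiple P Q : travelling P Q -> multiple P ->
  conf_of P (cor b0) = 2 :> nat.
Proof. by case=> _ _ tgt _ [q qR qb]; exact: (conf_two qR). Qed.

Lemma conf_target_single P Q : travelling P Q -> ~ multiple P ->
  conf_of P (cor b0) = 1 :> nat.
Proof.
case=> _ _ tgt _ nm; rewrite -tgt conf_one // => r; rewrite tgt => rb.
by apply: contrapT => /eqP rR; apply: nm; exists r.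
Qed.

Lemma conf_corner P Q z : travelling P Q -> z != b0 ->
  conf_of P (cor z) = (P (R z) == cor z) :> nat.
Proof.
case=> _ _ _ out zb; case: eqP => [Pz|nPz].
  by rewrite -Pz conf_one // => r; rewrite Pz => /out->.
by rewrite conf_zero // => r rz; apply: nPz; rewrite -(out _ _ zb rz).
Qed.

Definition multiple_at (f : config n) b :=
  f (cor b) = 2 :> nat /\ forall z, z != b -> f (cor z) <> 2 :> nat.

Lemma multiple_atP P Q : travelling P Q -> multiple P -> multiple_at (conf_of P) b0.
Proof.
move=> tr m; split; first exact: (conf_target_multiple tr m).
by move=> z zb; rewrite (conf_corner tr zb); case: (P (R z) == _).
Qed.

Lemma multiple_at_map (g : {perm node n}) gl f b : (forall b, g (cor b) = cor (gl b)) -> bijective gl ->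
  multiple_at f b -> multiple_at (conf_map g f) (gl b).
Proof.
move=> corE bij [two one]; split; first by rewrite -corE conf_map_perm.
have [gi glK giK] := bij.
move=> z; rewrite -(giK z) -corE conf_map_perm (inj_eq (bij_inj bij)); exact: one.
Qed.

End Travel.

(** * Asymmetric initial configurations *)

Section Asymmetric.
Variables (n k : nat) (a : 'I_n).
Hypothesis a_lt : a.*2.+3 < n.
Hypothesis n_even : ~~ odd n.
Variables (p0 : 'I_k -> node n) (R : label -> 'I_k) (b0 : label) (rr : 'I_k).
Hypothesis p0_inj : injective p0.
Hypothesis p0R : forall z, p0 (R z) = cor a z.
Hypothesis p0_sq : forall q, in_square a (p0 q).
Hypothesis rr_noncorner : ~~ is_corner a (p0 rr).
Hypothesis rr_closest : forall q z, ~~ is_corner a (p0 q) -> dl b0 (p0 rr) <= dl z (p0 q).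
Hypothesis p0_asym : forall g : {perm node n}, is_aut g ->
  conf_map g (conf_of p0) = conf_of p0 -> forall v, g v = v.

Local Notation cor := (cor a).
Local Notation good := (good a).
Local Notation travelling := (travelling a R b0).
Local Notation multiple := (multiple a R b0).
Implicit Types (P : 'I_k -> node n) (Q : 'I_k -> option (node n)) (f : config n).

Let rr_R z : rr != R z.
Proof. exact: (p0_nonR a_lt p0R). Qed.

Definition closest_pair f b v :=
  [/\ f v != ord0, ~~ is_corner a v & forall u z, f u != ord0 -> ~~ is_corner a u ->
      (u = v /\ z = b) \/ dl b v < dl z u].

(** [AsymInitial] recognizes a copy of the known starting configuration; the trivial stabilizer
    makes [g], and with it the target, unique. The other rules read the target off the
    configuration. *)
Inductive asym_rule f v w : Prop :=
| AsymMultiple b of multiple_at a f b & good b v w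
| AsymThree b of f (cor (opp b)) = 0 :> nat &
    (forall z, z != opp b -> f (cor z) = 1 :> nat) & ~~ is_corner a v & good b v w
| AsymClosest b v1 of (forall z, f (cor z) = 1 :> nat) & closest_pair f b v1 &
    v = v1 \/ v = cor (opp b) & good b v w
| AsymInitial g b of is_aut g & f = conf_map g (conf_of p0) & cor b = g (cor b0) &
    v = g (p0 rr) \/ v = cor (opp b) & good b v w.

Lemma asym_rule_adj f v w : asym_rule f v w -> adj v w.
Proof.
by case=> [b _ /and4P[]|b _ _ _ /and4P[]|b v1 _ _ _ /and4P[]|g b _ _ _ _ /and4P[]].
Qed.

Lemma asym_rule_aut (g : {perm node n}) f v w : is_aut g ->
  asym_rule f v w -> asym_rule (conf_map g f) (g v) (g w).
Proof.
move=> ag; have [gl [[bij oppE corE exE dlE] [sqE cE gE]]] := aut_labels a_lt ag.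
have [gi glK giK] := bij.
have four b : b = gl (gi b) by rewrite giK.
case=> [b m G|b f0 f1 nc G|b v1 f1 cl vE G|h b ah fE bE vE G].
- by apply: (@AsymMultiple _ _ _ (gl b)); rewrite ?gE //; exact: multiple_at_map m.
- apply: (@AsymThree _ _ _ (gl b)); rewrite ?gE ?cE // -?oppE -?corE ?conf_map_perm //.
  move=> z; rewrite (four z) -corE conf_map_perm (inj_eq (bij_inj bij)); exact: f1.
- apply: (@AsymClosest _ _ _ (gl b) (g v1)); rewrite ?gE //.
  + by move=> z; rewrite (four z) -corE conf_map_perm.
  + case: cl => occ nc lt; split; rewrite ?conf_map_perm ?cE // => u z.
    rewrite -(permKV g u) (four z) conf_map_perm cE !dlE => ou nu.
    by case: (lt _ (gi z) ou nu) => [[-> ->]|]; [left | right].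
  + by case: vE => [->|->]; [left | right; rewrite corE oppE].
- apply: (@AsymInitial _ _ _ (h * g)%g (gl b)); rewrite ?gE //.
  + by move=> u1 u2; rewrite !permM ag ah.
  + by rewrite fE conf_mapM.
  + by rewrite -corE bE permM.
  + by case: vE => [->|->]; [left; rewrite permM | right; rewrite corE oppE].
Qed.

(** The other three corner robots have at most null moves pending, so no second corner becomes
    empty. *)
Definition opposite_left P Q :=
  [/\ P (R (opp b0)) <> cor (opp b0), forall z, z != opp b0 -> P (R z) = cor z &
      forall z w, z != opp b0 -> Q (R z) = Some w -> w = cor z].

(** Only [rr] has left its place. The bounds on its coordinates put it in the quadrant of [b0], so
    that [b0] is strictly its nearest corner; good moves preserve them. *)
Definition walking P Q :=
  [/\ forall q, q != rr -> P q = p0 q, ~~ is_corner a (P rr),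
      P rr = p0 rr \/ dl b0 (P rr) < dl b0 (p0 rr),
      (rx b0 (P rr)).*2 < n.-1 /\ (ry b0 (P rr)).*2 < n.-1 &
      forall q w, q != rr -> q != R (opp b0) -> Q q = Some w -> w = P q].

Definition asym_inv P Q :=
  travelling P Q /\ [\/ multiple P, opposite_left P Q | walking P Q].

Lemma asym_inv0 : asym_inv p0 (fun _ => None).
Proof.
split; first exact: travelling0.
apply: Or33; split=> //; first by left.
(* Comparison with the two corners adjacent to [b0] bounds the two coordinates; since n is even, 2x
   = n - 1 is impossible and the bounds are strict. *)
have c1 := rr_closest (~~ b0.1, b0.2) rr_noncorner.
have c2 := rr_closest (b0.1, ~~ b0.2) rr_noncorner.
move: c1 c2; rewrite /dl !rxE !ryE.
have := ltn_ord (p0 rr).1; have := ltn_ord (p0 rr).2.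
by move: n_even; clear; case: b0 => [[] []] /=; lia.
Qed.

Lemma asym_corner_opp P Q : travelling P Q -> opposite_left P Q -> ~ multiple P ->
  conf_of P (cor (opp b0)) = 0 :> nat /\
  forall z, z != opp b0 -> conf_of P (cor z) = 1 :> nat.
Proof.
move=> tr [out stay _] nm; split.
  by rewrite (conf_corner tr) ?opp_neq //; case: eqP out.
move=> z zo; have [->|zb] := eqVneq z b0; first exact: (conf_target_single tr nm).
by rewrite (conf_corner tr zb) stay ?eqxx.
Qed.

Lemma asym_corner_walk P Q : travelling P Q -> walking P Q -> ~ multiple P ->
  forall z, conf_of P (cor z) = 1 :> nat.
Proof.
move=> tr [stay _ _ _ _] nm z.
have [->|zb] := eqVneq z b0; first exact: (conf_target_single tr nm).
rewrite (conf_corner tr zb) stay ?p0R ?eqxx //.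
by rewrite eq_sym.
Qed.

Lemma walking_occ P Q u : walking P Q -> conf_of P u != ord0 -> ~~ is_corner a u ->
  u = P rr \/ exists2 q, q != rr & u = p0 q.
Proof.
move=> [stay _ _ _ _] /conf_occP[q <-] _; have [->|qr] := eqVneq q rr; first by left.
by right; exists q; rewrite ?stay.
Qed.

(** Against other robots, [rr] is now below the initial minimum; against other corners, the quadrant
    bounds give strictness. *)
Lemma walking_closest P Q : walking P Q -> P rr <> p0 rr ->
  closest_pair (conf_of P) b0 (P rr).
Proof.
move=> wk moved; have [stay nc lt [qx qy] _] := wk.
have {}lt : dl b0 (P rr) < dl b0 (p0 rr) by case: lt.
split; rewrite ?conf_occ // => u z ou nu.
case: (walking_occ wk ou nu) => [uE|[q qr uE]]; last first.
  by right; apply: leq_trans lt _; rewrite uE; apply: rr_closest; rewrite -uE.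
rewrite uE; have [->|zb] := eqVneq z b0; [by left | right].
move: zb qx qy; rewrite /dl !rxE !ryE.
have := ltn_ord (P rr).1; have := ltn_ord (P rr).2; clear.
by case: b0 z => [[] []] [[] []] //=; lia.
Qed.

Lemma walking_unmoved P Q : walking P Q -> P rr = p0 rr -> P = p0.
Proof.
move=> [stay _ _ _ _] E; apply: funext => q.
by have [->|/stay] := eqVneq q rr.
Qed.

Lemma walking_rule P Q q w : travelling P Q -> walking P Q -> ~ multiple P ->
  asym_rule (conf_of P) (P q) w -> good b0 (P q) w /\ (q = rr \/ q = R (opp b0)).
Proof.
move=> tr wk nm; have f1 := asym_corner_walk tr wk nm.
have [stay nc lt _ _] := wk.
have at_opp : P q = cor (opp b0) -> q = R (opp b0).
  by case: tr => _ _ _; apply; rewrite opp_neq.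
have at_rr : P q = P rr -> q = rr.
  have [//|qr] := eqVneq q rr; rewrite stay // => qE.
  case: lt => [rE|]; first by apply: p0_inj; rewrite qE.
  by rewrite -qE ltnNge rr_closest // qE.
case=> [b [two _] _|b z0|b v1 _ cl vE G|g b ag fE bE vE G].
- by rewrite f1 in two.
- by rewrite f1 in z0.
(* Before [rr] moves, [(rr, b0)] attains the minimum, so a strictly closest pair must be this one;
   afterwards two strictly closest pairs coincide. *)
- have [bE v1E] : b = b0 /\ v1 = P rr.
    case: cl => o1 nc1 cl1.
    have [rE|rE] := pselect (P rr = p0 rr).
      have [|] := cl1 (P rr) b0 (conf_occ _ _) nc; first by case=> -> ->.
      have PE := walking_unmoved wk rE.
      rewrite rE ltnNge; case/conf_occP: o1 nc1 => s <-; rewrite PE => ns.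
      by rewrite rr_closest.
    have [_ _ cl2] := walking_closest wk rE.
    have [|lt1] := cl1 (P rr) b0 (conf_occ _ _) nc; first by case=> -> ->.
    have [|lt2] := cl2 v1 b o1 nc1; first by case=> -> ->.
    by move: lt1 lt2; lia.
  move: vE G; rewrite bE v1E => vE ->; split=> //.
  by case: vE => [/at_rr|/at_opp]; [left | right].
- have [gl [[bij oppE corE _ dlE] [_ cE _]]] := aut_labels a_lt ag.
  have [gi glK giK] := bij.
  (* Had [rr] moved, it would be closer to a corner than any initial non-corner robot is, and the
     configuration would not be a copy of the initial one. *)
  have rE : P rr = p0 rr.
    case: lt => // lt; have := conf_occ P rr; rewrite fE -(permKV g (P rr)) conf_map_perm.
    case/conf_occP => s sE.
    have dE : dl (gi b0) (p0 s) = dl b0 (P rr) by rewrite -dlE giK sE permKV.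
    have ns : ~~ is_corner a (p0 s) by rewrite -cE sE permKV.
    by move: lt; rewrite -dE ltnNge rr_closest.
  have PE := walking_unmoved wk rE.
  have g1 v : g v = v by apply: p0_asym; rewrite // -fE PE.
  have bb : b = b0 by apply: (cor_inj a_lt); rewrite bE g1.
  move: vE G; rewrite bb g1 -rE => vE ->; split=> //.
  by case: vE => [/at_rr|/at_opp]; [left | right].
Qed.

(** All other rules require at most one robot on each corner, so only the rule for a multiplicity
    can fire. *)
Lemma asym_multiple_rule P Q q w : travelling P Q -> multiple P ->
  asym_rule (conf_of P) (P q) w -> good b0 (P q) w.
Proof.
move=> tr m; have two := conf_target_multiple tr m.
case=> [b [_ one] G|b f0 f1 _ _|b v1 f1 _ _ _|g b ag fE _ _ _].
- have [<-//|bb] := eqVneq b b0.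
  by case: (one b0); rewrite ?two // eq_sym.
- have [bE|/f1] := eqVneq b0 (opp b); last by rewrite two.
  by rewrite -bE two in f0.
- by rewrite f1 in two.
- by rewrite fE (conf_map0_corner a_lt p0_inj p0R) in two.
Qed.

Lemma asym_three_rule P Q q w : travelling P Q -> opposite_left P Q -> ~ multiple P ->
  asym_rule (conf_of P) (P q) w -> good b0 (P q) w /\ ~~ is_corner a (P q).
Proof.
move=> tr ol nm; have [c0 c1] := asym_corner_opp tr ol nm.
case=> [b [two _] _|b f0 _ nc G|b v1 f1 _ _ _|g b ag fE _ _ _].
- have [bE|/c1] := eqVneq b (opp b0); last by rewrite two.
  by rewrite bE c0 in two.
- have bb : b = b0.
    by apply: (can_inj oppK); apply/eqP/negPn/negP => /c1; rewrite f0.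
  by rewrite -bb.
- by rewrite f1 in c0.
- by rewrite fE (conf_map0_corner a_lt p0_inj p0R) in c0.
Qed.

Lemma asym_inv_look P Q r w : asym_inv P Q -> Q r = None ->
  asym_rule (conf_of P) (P r) w \/ w = P r ->
  asym_inv P (fun r' => if r' == r then Some w else Q r').
Proof.
move=> [tr st] _ rw.
suff [ok stE] : (w = P r \/ good b0 (P r) w) /\
    [\/ multiple P, opposite_left P (fun r' => if r' == r then Some w else Q r')
      | walking P (fun r' => if r' == r then Some w else Q r')].
  by split=> //; apply: travelling_look.
have [m|nm] := pselect (multiple P).
  split; last exact: Or31.
  by case: rw => [/(asym_multiple_rule tr m)|]; [right | left].
case: st => // st.
  have [out stay pend] := st.
  case: rw => [/(asym_three_rule tr st nm)[G nc]|wE].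
    split; first by right.
    apply: Or32; split=> // z w' zo; case: eqP => [zr|_]; last exact: pend.
    by move: nc; rewrite -zr stay // cor_corner.
  split; first by left.
  apply: Or32; split=> // z w' zo; case: eqP => [zr [<-]|_]; last exact: pend.
  by rewrite wE -zr stay.
have [stay nc lt quad pend] := st.
case: rw => [/(walking_rule tr st nm)[G rE]|wE].
  split; first by right.
  apply: Or33; split=> // q w' qr qo; case: eqP => [qE|_]; last exact: pend.
  by case: rE => rE; move: qr qo; rewrite qE rE eqxx.
split; first by left.
apply: Or33; split=> // q w' qr qo; case: eqP => [-> [<-]|_]; [by []|exact: pend].
Qed.

Lemma asym_inv_move P Q r w : asym_inv P Q -> Q r = Some w ->
  asym_inv (fun r' => if r' == r then w else P r')
           (fun r' => if r' == r then None else Q r').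
Proof.
move=> [tr st] Qr; split; first exact: travelling_move.
have [m|nm] := pselect (multiple P).
  by apply: Or31; exact: (multiple_upd a_lt tr Qr m).
have [_ pendT tgt outT] := tr.
have [wE|G] := pendT _ _ Qr.
  rewrite wE upd_same; case: st => // [[out stay pend]|[stay nc lt quad pend]].
    by apply: Or32; split=> // z w' zo; case: eqP => // _; exact: pend.
  by apply: Or33; split=> // q w' qr qo; case: eqP => // _; exact: pend.
have rb : r != R b0.
  by apply/eqP => rb; move: G; rewrite rb tgt (negPf (good_target a_lt b0 w)).
have wo z : w = cor z -> z = b0 by move=> wz; move: G; rewrite wz => /(good_corner a_lt).
case: st => // [[out stay pend]|[stay nc lt [qx qy] pend]].
  have rR z : z != opp b0 -> R z != r.
    move=> zo; apply/eqP => zr; have := pend z w zo; rewrite zr => /(_ Qr) wz.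
    by move: rb; rewrite -zr (wo _ wz) eqxx.
  apply: Or32; split.
  - by case: eqP => // _ /wo/eqP; rewrite opp_neq.
  - by move=> z zo; rewrite (negPf (rR z zo)) stay.
  - by move=> z w' zo; rewrite (negPf (rR z zo)); exact: pend.
(* The departure of the robot opposite to the target starts the phase [opposite_left], wherever [rr]
   is. *)
have [ro|ro] := eqVneq r (R (opp b0)).
  have rrr : rr != r by rewrite ro.
  have RE z : z != opp b0 -> (R z == r) = false.
    by move=> zo; rewrite ro (inj_eq (R_inj a_lt p0R)) (negPf zo).
  have PR z : P (R z) = cor z by rewrite stay ?p0R // eq_sym.
  apply: Or32; split.
  - by rewrite ro eqxx => /wo/eqP; rewrite opp_neq.
  - by move=> z zo; rewrite RE.
  - move=> z w' zo; rewrite RE // => /pend ->; rewrite ?PR //.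
      by rewrite eq_sym.
    by rewrite -ro RE.
have [rE|rn] := eqVneq r rr; last first.
  by move: G; rewrite (pend _ _ rn ro Qr) => /(good_coord a_lt)[]; lia.
have [wb|wb] := eqVneq w (cor b0).
  by apply: Or31; exists r => //; rewrite eqxx.
have [d x y _] := good_coord a_lt G.
rewrite rE in d x y *; apply: Or33; split; rewrite ?eqxx.
- by move=> q qr; rewrite (negPf qr) stay.
- by case/and4P: G => _ _ _; rewrite (negPf wb).
- by right; case: lt => [<-|lt]; move: d; lia.
- by move: x y qx qy; lia.
- by move=> q w' qr qo; rewrite (negPf qr); exact: pend.
Qed.

(** With a multiplicity on the target, every robot elsewhere has a move. Otherwise two distinct
    robots with a move suffice, as [z] is at most one of them: in both phases [rr] and the robot
    that started opposite to the target. *)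
Lemma asym_no_deadlock P Q (z : option 'I_k) : asym_inv P Q ->
  (forall r, Some r != z -> forall w, ~ asym_rule (conf_of P) (P r) w) ->
  forall r, Some r != z -> P r = cor b0.
Proof.
move=> [tr st] dis; have [sq _ tgt outT] := tr.
have step q : P q != cor b0 -> exists w, good b0 (P q) w.
  by move=> ne; apply: good_exists.
have [m|nm] := pselect (multiple P).
  move=> r rz; apply/eqP/negPn/negP => /step[w G].
  by apply: (dis r rz w); apply: (AsymMultiple (multiple_atP tr m) G).
have stuck q r : q != r ->
    (forall s, s = q \/ s = r -> exists w, asym_rule (conf_of P) (P s) w) -> False.
  move=> qr en; have [zq|zq] := eqVneq (Some q) z.
    have [w] := en r (or_intror erefl); apply: dis.
    by rewrite -zq (inj_eq Some_inj) eq_sym.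
  by have [w] := en q (or_introl erefl); apply: dis.
have nonc_ne q : ~~ is_corner a (P q) -> P q != cor b0.
  by apply: contra => /eqP ->; exact: cor_corner.
have rrR := rr_R (opp b0).
case: st => // st; exfalso; apply: (stuck _ _ rrR).
  have [out stay pend] := st; have [c0 c1] := asym_corner_opp tr st nm.
  move=> s sE; have nc : ~~ is_corner a (P s).
    apply/negP => /(is_cornerP a_lt)[y sy]; case: sE => sE; last first.
      have [yo|yo] := eqVneq y (opp b0); first by apply: out; rewrite -sE sy yo.
      have [yb|yb] := eqVneq y b0.
        by apply: nm; exists s; rewrite ?sy ?yb // sE (inj_eq (R_inj a_lt p0R)) opp_neq.
      by move: (outT _ _ yb sy); rewrite sE => /(R_inj a_lt p0R)/eqP; rewrite eq_sym (negPf yo).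
    have [yb|yb] := eqVneq y b0.
      by apply: nm; exists s; rewrite ?sy ?yb // sE.
    by have := outT _ _ yb sy; rewrite sE; apply/eqP.
  have [w G] := step _ (nonc_ne _ nc); exists w.
  exact: (AsymThree c0 c1 nc G).
have [stay nc lt quad pend] := st.
have c1 := asym_corner_walk tr st nm.
move=> s sE.
have ne : P s != cor b0.
  case: sE => ->; first exact: nonc_ne.
  by rewrite stay ?p0R ?(inj_eq (cor_inj a_lt)) ?opp_neq // eq_sym.
have vE : P s = P rr \/ P s = cor (opp b0).
  by case: sE => ->; [left | right; rewrite stay ?p0R // eq_sym].
have [w G] := step _ ne; exists w.
have [rE|rE] := pselect (P rr = p0 rr); last first.
  exact: (AsymClosest c1 (walking_closest st rE) vE G).
have PE := walking_unmoved st rE.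
apply: (@AsymInitial _ _ _ 1%g b0) => //; rewrite ?perm1 //.
- by move=> u v; rewrite !perm1.
- by apply/ffunP => v; rewrite PE !ffunE invg1 perm1.
- by rewrite -rE.
Qed.

Lemma asym_gatherable : gatherable_1crash p0.
Proof.
apply: (@gatherable_of_relation _ _ asym_rule asym_rule_adj asym_rule_aut p0 (cor b0)
  (dl b0) asym_inv).
- exact: asym_inv0.
- exact: asym_inv_look.
- exact: asym_inv_move.
- by move=> P Q r w [tr _]; exact: (travelling_dl a_lt tr).
- exact: asym_no_deadlock.
Qed.

End Asymmetric.

(** * Initial configurations with a diagonal symmetry *)

Section Symmetric.
Variables (n k : nat) (a : 'I_n).
Hypothesis a_lt : a.*2.+3 < n.

Local Notation cor := (cor a).
Local Notation good := (good a).
Local Notation exit := (exit a_lt).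
Implicit Types (P : 'I_k -> node n) (Q : 'I_k -> option (node n)) (f : config n).
Implicit Types (u v w : node n) (b : label).

Definition side (z b : label) := (z != b) && (z != opp b).

Lemma side_opp z b : side z (opp b) = side z b.
Proof. by rewrite /side oppK andbC. Qed.

Lemma opp_side z b : side (opp z) b = side z b.
Proof. by rewrite /side !(can2_eq oppK oppK) oppK andbC. Qed.

Lemma sideP z b y : side z b -> side y b -> y = z \/ y = opp z.
Proof. by case: z b y => [[] []] [[] []] [[] []]; auto. Qed.

Lemma side_cases b z : [\/ z = b, z = opp b | side z b].
Proof. by case: b z => [[] []] [[] []]; first [by apply: Or31 | by apply: Or32 | by apply: Or33]. Qed.

Definition noncorner_of f v := f v != ord0 /\ ~~ is_corner a v.

(** A comparison of the least distances to [b] and to [opp b], phrased without minima; [near_le] is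
    the weak version and also covers the absence of non-corner robots. *)
Definition nearer f b := exists2 v, noncorner_of f v &
  forall u, noncorner_of f u -> dl b v < dl (opp b) u.

Definition near_le f b := forall u, noncorner_of f u ->
  exists2 v, noncorner_of f v & dl b v <= dl (opp b) u.

Definition closest f b v :=
  ~~ is_corner a v /\ forall u, noncorner_of f u -> dl b v <= dl b u.

(* Selects one of the two opposite corners [b] and [opp b]; ties between the
   distances of the nearest robots are broken by the first move of a side robot. *)
Definition selects f b := nearer f b \/ near_le f b /\
  forall z, side z b -> f (cor z) = 0 :> nat -> f (exit z (opp b)) < f (exit z b).

(** The empty corner reveals the axis, because both ends of the axis are occupied; [selects] then
    distinguishes the ends. *)
Definition balanced_at f b :=
  [/\ f (cor b) = 1 :> nat, f (cor (opp b)) = 1 :> nat,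
      forall z, side z b -> f (cor z) <= 1,
      exists2 z, side z b & f (cor z) = 0 :> nat & selects f b].

(** A strict inequality between the minima excludes any reverse one; in a tie, the two exits of the
    empty corner [z] would be compared strictly in both directions. *)
Lemma selects_anti f b z : side z b -> f (cor z) = 0 :> nat ->
  selects f b -> ~ selects f (opp b).
Proof.
rewrite /selects /nearer /near_le oppK => zb z0.
case=> [[v ov lt]|[le ex]] [[u ou lt']|[le' ex']].
- by have := lt _ ou; have := lt' _ ov; lia.
- by have [u ou le''] := le' _ ov; have := lt _ ou; lia.
- by have [v ov le''] := le _ ou; have := lt' _ ov; lia.
- by have := ex _ zb z0; have := ex' z; rewrite side_opp => /(_ zb z0); lia.
Qed.

(** * Transport of these notions by an automorphism *)

Section Map.
Variables (g : {perm node n}) (gl : label -> label).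
Hypothesis ag : is_aut g.
Hypothesis bij : bijective gl.
Hypothesis oppE : forall b, gl (opp b) = opp (gl b).
Hypothesis corE : forall b, g (cor b) = cor (gl b).
Hypothesis exE : forall z b, g (exit z b) = exit (gl z) (gl b).
Hypothesis dlE : forall b v, dl (gl b) (g v) = dl b v.
Hypothesis cE : forall v, is_corner a (g v) = is_corner a v.

Lemma side_map z b : side (gl z) (gl b) = side z b.
Proof. by rewrite /side -oppE !(inj_eq (bij_inj bij)). Qed.

Lemma noncorner_of_map f v : noncorner_of (conf_map g f) (g v) <-> noncorner_of f v.
Proof. by rewrite /noncorner_of conf_map_perm cE. Qed.

Lemma closest_map f b v : closest f b v -> closest (conf_map g f) (gl b) (g v).
Proof.
case=> nc le; split; rewrite ?cE // => u.
by rewrite -(permKV g u) => /noncorner_of_map /le; rewrite !dlE.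
Qed.

Lemma selects_map f b : selects f b -> selects (conf_map g f) (gl b).
Proof.
have [gi _ giK] := bij.
case=> [[v ov lt]|[le ex]]; [left | right].
  exists (g v); first exact/noncorner_of_map.
  by move=> u; rewrite -(permKV g u) => /noncorner_of_map /lt; rewrite -oppE !dlE.
split=> [u|z].
  rewrite -(permKV g u) => /noncorner_of_map /le [v ov le'].
  by exists (g v); [exact/noncorner_of_map | rewrite -oppE !dlE].
by rewrite -(giK z) side_map -corE -oppE -!exE !conf_map_perm; exact: ex.
Qed.

Lemma balanced_at_map f b : balanced_at f b -> balanced_at (conf_map g f) (gl b).
Proof.
have [gi _ giK] := bij.
case=> f1 f2 le [z zs z0] sel; split; rewrite -?oppE -?corE ?conf_map_perm //.
- by move=> y; rewrite -(giK y) side_map -corE conf_map_perm; exact: le.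
- by exists (gl z); rewrite ?side_map // -corE conf_map_perm.
- exact: selects_map.
Qed.

End Map.

(** * The protocol for a diagonal symmetry and its invariant *)

Variables (p0 : 'I_k -> node n) (R : label -> 'I_k) (b0 : label).
Hypothesis p0_inj : injective p0.
Hypothesis p0R : forall z, p0 (R z) = cor z.
Hypothesis p0_sq : forall q, in_square a (p0 q).
Hypothesis p0_axis : forall g : {perm node n}, is_aut g ->
  conf_map g (conf_of p0) = conf_of p0 -> g (cor b0) = cor b0.
(** In a tie the exit towards [b0] is at least as occupied as the one towards [opp b0], so it is
    strictly ahead once the side robot has stepped on it. *)
Hypothesis p0_near : nearer (conf_of p0) b0 \/ near_le (conf_of p0) b0 /\
  forall z, side z b0 -> (exists q, p0 q = exit z (opp b0)) -> exists q, p0 q = exit z b0.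

Local Notation travelling := (travelling a R b0).
Local Notation multiple := (multiple a R b0).

(** [SymSide] and [SymOpposite] give a second enabled robot besides the one of [SymClosest].
    [SymOpposite] waits until both side corners are empty, so that its robot leaves the target as
    the only occupied corner. *)
Inductive sym_rule f v w : Prop :=
| SymMultiple b of multiple_at a f b & good b v w
| SymAlone b of f (cor b) = 1 :> nat & (forall z, z != b -> f (cor z) = 0 :> nat) & good b v w
| SymClosest b of balanced_at f b & closest f b v & good b v w
| SymSide b z of balanced_at f b & side z b & v = cor z & f (cor (opp z)) = 0 :> nat & good b v w
| SymOpposite b of balanced_at f b & v = cor (opp b) &
    (forall z, side z b -> f (cor z) = 0 :> nat) & good b v w
| SymInitial g b of is_aut g & f = conf_map g (conf_of p0) & cor b = g (cor b0) &
    (exists2 z, side z b & v = cor z) & good b v w.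

Lemma sym_rule_adj f v w : sym_rule f v w -> adj v w.
Proof.
by case=> [b _ /and4P[]|b _ _ /and4P[]|b _ _ /and4P[]|b z _ _ _ _ /and4P[]
  |b _ _ _ /and4P[]|g b _ _ _ _ /and4P[]].
Qed.

Lemma sym_rule_aut (g : {perm node n}) f v w : is_aut g ->
  sym_rule f v w -> sym_rule (conf_map g f) (g v) (g w).
Proof.
move=> ag; have [gl [[bij oppE corE exE dlE] [sqE cE gE]]] := aut_labels a_lt ag.
have [gi glK giK] := bij.
have bal := balanced_at_map bij oppE corE exE dlE cE.
have sideE := side_map bij oppE.
case=> [b m G|b f1 f0 G|b B cl G|b z B zb vE f0 G|b B vE f0 G|h b ah fE bE [z zb vE] G].
- by apply: (@SymMultiple _ _ _ (gl b)); rewrite ?gE //; exact: multiple_at_map m.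
- apply: (@SymAlone _ _ _ (gl b)); rewrite ?gE -?corE ?conf_map_perm // => z.
  by rewrite -(giK z) -corE conf_map_perm (inj_eq (bij_inj bij)); exact: f0.
- by apply: (@SymClosest _ _ _ (gl b)); rewrite ?gE //; [exact: bal | exact: closest_map].
- apply: (@SymSide _ _ _ (gl b) (gl z)); rewrite ?gE ?sideE //; first exact: bal.
    by rewrite vE corE.
  by rewrite -oppE -corE conf_map_perm.
- apply: (@SymOpposite _ _ _ (gl b)); rewrite ?gE //; first exact: bal.
    by rewrite vE corE oppE.
  by move=> z; rewrite -(giK z) sideE -corE conf_map_perm; exact: f0.
- apply: (@SymInitial _ _ _ (h * g)%g (gl b)); rewrite ?gE //.
  + by move=> u1 u2; rewrite !permM ag ah.
  + by rewrite fE conf_mapM.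
  + by rewrite -corE bE permM.
  + by exists (gl z); rewrite ?sideE // vE corE.
Qed.

Definition alone P := forall z, z != b0 -> P (R z) <> cor z.

Definition started P Q := P = p0 /\
  forall q w, Q q = Some w -> w = P q \/ exists2 z, side z b0 & q = R z.

(** Only side robots have moved, each at most onto its exit, so the exits still break the tie. A
    real move pending at a non-corner node belongs to a closest robot, hence executing it makes [b0]
    strictly nearer. *)
Definition undecided P Q :=
  [/\ forall q, ~~ is_corner a (p0 q) -> P q = p0 q,
      forall z, side z b0 -> P (R z) = cor z \/ P (R z) = exit z b0,
      near_le (conf_of P) b0,
      forall q w, ~~ is_corner a (P q) -> Q q = Some w ->
        w = P q \/ closest (conf_of P) b0 (P q) &
      forall z, side z b0 -> (exists q, p0 q = exit z (opp b0)) ->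
        exists q, p0 q = exit z b0].

Definition balanced P Q :=
  [/\ P (R (opp b0)) = cor (opp b0), exists2 z, side z b0 & P (R z) <> cor z,
      forall w, Q (R (opp b0)) = Some w ->
        w = cor (opp b0) \/ forall z, side z b0 -> P (R z) <> cor z &
      nearer (conf_of P) b0 \/ undecided P Q].

Definition sym_inv P Q :=
  travelling P Q /\ [\/ multiple P, alone P, balanced P Q | started P Q].

Let b0_opp : (opp b0 == b0) = false.
Proof. exact: opp_neq. Qed.

Lemma side_neq z b : side z b -> z != b /\ z != opp b.
Proof. by move/andP. Qed.

Lemma sym_inv0 : sym_inv p0 (fun _ => None).
Proof. by split; [exact: travelling0 | apply: Or44]. Qed.

Lemma conf_single P Q z : travelling P Q -> ~ multiple P ->
  conf_of P (cor z) = (P (R z) == cor z) :> nat.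
Proof.
move=> tr nm; have [->|zb] := eqVneq z b0; last exact: (conf_corner tr zb).
by rewrite (conf_target_single tr nm); case: tr => _ _ -> _; rewrite eqxx.
Qed.

Lemma corner_robot P Q q : travelling P Q -> ~ multiple P -> is_corner a (P q) ->
  exists2 z, q = R z & P q = cor z.
Proof.
move=> tr nm /(is_cornerP a_lt)[z qz]; exists z => //.
have [zb|zb] := eqVneq z b0; last by case: tr => _ _ _; apply.
by apply: contrapT => /eqP qR; apply: nm; exists q; rewrite -?zb.
Qed.

Lemma noncorner_robot P q : ~~ is_corner a (P q) -> noncorner_of (conf_of P) (P q).
Proof. by split=> //; exact: conf_occ. Qed.

Lemma noncorner_ofP P u : noncorner_of (conf_of P) u ->
  exists2 q, P q = u & ~~ is_corner a (P q).
Proof. by case=> /conf_occP[q <-] nc; exists q. Qed.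

(** The exit towards [opp b0] holds at most a robot that started there. If it holds one, another
    robot started on the exit towards [b0] and forms a multiplicity with [R z]; if none, [R z] alone
    suffices. *)
Lemma undecided_exit P Q z : travelling P Q -> ~ multiple P -> balanced P Q -> undecided P Q ->
  side z b0 -> P (R z) <> cor z ->
  conf_of P (exit z (opp b0)) < conf_of P (exit z b0).
Proof.
move=> tr nm [Po _ _ _] [stay sides _ _ occ] zs nz.
have [zb zo] := side_neq zs.
have Pz : P (R z) = exit z b0 by case: (sides z zs).
have at_exit q : P q = exit z (opp b0) -> p0 q = exit z (opp b0).
  move=> qe; have nce : ~~ is_corner a (P q) by rewrite qe exit_corner ?oppK.
  have [/(is_cornerP a_lt)[y qy]|nc] := boolP (is_corner a (p0 q)); last by rewrite -stay.
  have qR : q = R y by apply: (p0_corner p0_inj p0R).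
  case: (side_cases b0 y) => [yE|yE|ys].
  - by move: nce; rewrite qR yE; case: tr => _ _ -> _; rewrite cor_corner.
  - by move: nce; rewrite qR yE Po cor_corner.
  have [yb yo] := side_neq ys.
  case: (sides y ys) => [Py|Py]; first by move: nce; rewrite qR Py cor_corner.
  by have := exit_neq a_lt zb zo yb yo; rewrite -Py -qR qe eqxx.
have e_pos : 0 < conf_of P (exit z b0) by rewrite -Pz lt0n; exact: conf_occ.
have le1 : conf_of P (exit z (opp b0)) <= 1.
  by apply: conf_le1 => q r /at_exit qe /at_exit re; apply: p0_inj; rewrite qe.
have [/conf_occP[q /at_exit qe]|] := boolP (conf_of P (exit z (opp b0)) != ord0); last first.
  by rewrite negbK => /eqP ->.
have [q' qe'] := occ z zs (ex_intro _ q qe).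
have Pq' : P q' = exit z b0 by rewrite stay ?qe' ?exit_corner.
rewrite (@conf_two _ _ P (R z) q' (exit z b0)) //.
apply/eqP => zq; move: (exit_corner a_lt zb zo); rewrite -qe' -zq p0R.
by rewrite cor_corner.
Qed.

Lemma balanced_atP P Q : travelling P Q -> ~ multiple P -> balanced P Q ->
  balanced_at (conf_of P) b0.
Proof.
move=> tr nm bal; have [Po [z zs nz] _ sc] := bal.
have c := conf_single _ tr nm.
split; rewrite ?c ?Po ?eqxx //.
- by case: tr => _ _ -> _; rewrite eqxx.
- by move=> y _; rewrite c; case: (_ == _).
- by exists z; rewrite ?c //; case: eqP nz.
case: sc => [|und]; [by left | right; split; first by case: und].
move=> y ys; rewrite c; case: eqP => // ny _; exact: (undecided_exit tr nm bal und ys ny).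
Qed.

(** A side label [b] is impossible: one of [cor b] and [cor (opp b)] would be the empty side corner.
    [selects_anti] excludes [opp b0]. *)
Lemma balanced_at_uniq f b : balanced_at f b0 -> balanced_at f b -> b = b0.
Proof.
move=> [_ _ _ [z zs z0] s0] [fb fo _ _ sb].
case: (side_cases b0 b) => // [bE|bs].
  by case: (selects_anti zs z0 s0); rewrite -bE.
by case: (sideP bs zs) => zE; move: z0; rewrite zE ?fb ?fo.
Qed.

Lemma sym_multiple_rule P Q q w : travelling P Q -> multiple P ->
  sym_rule (conf_of P) (P q) w -> good b0 (P q) w.
Proof.
move=> tr m; have two := conf_target_multiple tr m.
have nbal b : ~ balanced_at (conf_of P) b.
  case=> f1 f2 le _ _; case: (side_cases b b0) => [bE|bE|/le]; last by rewrite two.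
    by rewrite -bE two in f1.
  by rewrite -bE two in f2.
case=> [b [_ one] G|b f1 f0 _|b B|b z B|b B|g b ag fE _ _ _]; try by case: (nbal b).
- have [<-//|bb] := eqVneq b b0.
  by case: (one b0); rewrite ?two // eq_sym.
- have [bE|/f0] := eqVneq b0 b; last by rewrite two.
  by rewrite -bE two in f1.
- by rewrite fE (conf_map0_corner a_lt p0_inj p0R) in two.
Qed.

Lemma sym_alone_rule P Q q w : travelling P Q -> alone P -> ~ multiple P ->
  sym_rule (conf_of P) (P q) w -> good b0 (P q) w.
Proof.
move=> tr al nm; have c := conf_single _ tr nm.
have c0 z : z != b0 -> conf_of P (cor z) = 0 :> nat.
  by move=> /al nz; rewrite c; case: eqP nz.
have nbal b : ~ balanced_at (conf_of P) b.
  case=> f1 f2 _ _ _; have [bE|/c0] := eqVneq b b0; last by rewrite f1.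
  by move: f2; rewrite c0 // bE b0_opp.
case=> [b [two _] _|b f1 f0 G|b B|b z B|b B|g b ag fE _ _ _]; try by case: (nbal b).
- by move: two; rewrite c; case: (_ == _).
- by have [<-//|/c0] := eqVneq b b0; rewrite f1.
- have := c0 (opp b0); rewrite b0_opp fE (conf_map0_corner a_lt p0_inj p0R) //.
  by move/(_ isT).
Qed.

Lemma sym_balanced_rule P Q q w : travelling P Q -> balanced P Q -> ~ multiple P ->
  sym_rule (conf_of P) (P q) w -> good b0 (P q) w /\
  [\/ closest (conf_of P) b0 (P q), exists2 z, side z b0 & P q = cor z |
      P q = cor (opp b0) /\ forall z, side z b0 -> P (R z) <> cor z].
Proof.
move=> tr bal nm; have c := conf_single _ tr nm; have B0 := balanced_atP tr nm bal.
have [Po [z0 zs0 nz0] _ _] := bal.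
have c1 : conf_of P (cor b0) = 1 :> nat by case: B0.
case=> [b [two _] _|b f1 f0 _|b B cl G|b z B zs qz f0 G|b B qo f0 G|g b ag fE _ _ _].
- by move: two; rewrite c; case: (_ == _).
- have [bE|bb] := eqVneq b b0; last by move: c1; rewrite f0 // eq_sym.
  by have := f0 (opp b0); rewrite bE b0_opp c Po eqxx => /(_ isT).
- by move: G cl; rewrite (balanced_at_uniq B0 B) => G cl; split=> //; apply: Or31.
- move: zs G; rewrite (balanced_at_uniq B0 B) => zs G; split=> //.
  by apply: Or32; exists z.
- move: qo f0 G; rewrite (balanced_at_uniq B0 B) => qo f0 G; split=> //.
  apply: Or33; split=> // z zs zE; have := f0 z zs.
  by rewrite c zE eqxx.
- by have := c z0; case: eqP nz0 => // _ _; rewrite fE (conf_map0_corner a_lt p0_inj p0R).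
Qed.

(** The [g] of [SymInitial] can be the reflection, but it fixes [cor b0], so every choice of [g]
    yields the same target. *)
Lemma sym_started_rule q w : sym_rule (conf_of p0) (p0 q) w ->
  good b0 (p0 q) w /\ exists2 z, side z b0 & q = R z.
Proof.
have c := conf0_corner p0_inj p0R.
have nbal b : ~ balanced_at (conf_of p0) b by case=> _ _ _ [z _]; rewrite c.
case=> [b [two _] _|b f1 f0 _|b B|b z B|b B|g b ag fE bE [z zs qz] G]; try by case: (nbal b).
- by rewrite c in two.
- by have := f0 (opp b); rewrite opp_neq c => /(_ isT).
- have bb : b = b0 by apply: (cor_inj a_lt); rewrite bE p0_axis.
  move: zs G; rewrite bb => zs ->; split=> //.
  by exists z => //; apply: (p0_corner p0_inj p0R).
Qed.

Lemma sym_inv_look P Q r w : sym_inv P Q -> Q r = None ->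
  sym_rule (conf_of P) (P r) w \/ w = P r ->
  sym_inv P (fun r' => if r' == r then Some w else Q r').
Proof.
move=> [tr st] _ rw.
suff [ok stE] : (w = P r \/ good b0 (P r) w) /\
    [\/ multiple P, alone P, balanced P (fun r' => if r' == r then Some w else Q r')
      | started P (fun r' => if r' == r then Some w else Q r')].
  by split=> //; apply: travelling_look.
have [m|nm] := pselect (multiple P).
  split; last exact: Or41.
  by case: rw => [/(sym_multiple_rule tr m)|]; [right | left].
case: st => // [al|bal|[PE pend]].
- split; last exact: Or42.
  by case: rw => [/(sym_alone_rule tr al nm)|]; [right | left].
- have [Po miss pendo sc] := bal.
  have ok : (w = P r \/ good b0 (P r) w) /\ (w = P r \/
    [\/ closest (conf_of P) b0 (P r), exists2 z, side z b0 & P r = cor z |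
      P r = cor (opp b0) /\ forall z, side z b0 -> P (R z) <> cor z]).
    case: rw => [/(sym_balanced_rule tr bal nm)[G kind]|wE]; last by split; left.
    by split; right.
  case: ok => ok kind; split=> //; apply: Or43; split=> //.
    move=> w'; case: eqP => [rE [<-]|_]; last exact: pendo.
    rewrite -rE Po in kind; case: kind => [->|[[]|[z zs /(cor_inj a_lt) zE]|[]]].
    + by left.
    + by rewrite cor_corner.
    + by move: zs; rewrite -zE /side eqxx andbF.
    + by right.
  case: sc => [|[stay sides le pend occ]]; [by left | right; split=> //].
  move=> q w' nc; case: eqP => [qE [<-]|_]; last exact: pend.
  rewrite -qE in kind; case: kind => [->|[|[z _ qz]|[qo _]]]; [by left|by right| |].
    by rewrite qz cor_corner in nc.
  by rewrite qo cor_corner in nc.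
have kind : (w = P r \/ good b0 (P r) w) /\ (w = P r \/ exists2 z, side z b0 & r = R z).
  case: rw => [|->]; last by split; left.
  by rewrite PE => /sym_started_rule[G ex]; split; right.
case: kind => ok kind; split=> //; apply: Or44; split=> // q w'.
by case: eqP => [-> [<-]|_]; [|exact: pend].
Qed.

(** * Effect of a single move on the choice of the target *)

Let upd P r w := fun r' : 'I_k => if r' == r then w else P r'.

Lemma upd_noncorner P r w u : ~~ is_corner a w ->
  noncorner_of (conf_of (upd P r w)) u ->
  u = w \/ exists2 q, q != r & u = P q.
Proof.
move=> nw /noncorner_ofP[q <- _]; rewrite /upd.
by case: eqP => [_|/eqP qr]; [left | right; exists q].
Qed.

Lemma upd_keeps P r w q : q != r -> ~~ is_corner a (P q) ->
  noncorner_of (conf_of (upd P r w)) (P q).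
Proof.
move=> qr nc; have -> : P q = upd P r w q by rewrite /upd (negPf qr).
by apply: noncorner_robot; rewrite /upd (negPf qr).
Qed.

Lemma upd_new P r w : ~~ is_corner a w -> noncorner_of (conf_of (upd P r w)) w.
Proof.
move=> nw; have {2}-> : w = upd P r w r by rewrite /upd eqxx.
by apply: noncorner_robot; rewrite /upd eqxx.
Qed.

Lemma nearer_exit P r z : side z b0 -> P r = cor z ->
  nearer (conf_of P) b0 -> nearer (conf_of (upd P r (exit z b0))) b0.
Proof.
move=> /side_neq[zb zo] rz [v ov lt].
have nc := exit_corner a_lt zb zo; have [_ dop] := dl_exit a_lt zb zo.
have [q qv nq] := noncorner_ofP ov.
have qr : q != r by apply: contraNneq nq => ->; rewrite rz cor_corner.
exists v; first by rewrite -qv; exact: upd_keeps.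
move=> u ou; case: (upd_noncorner nc ou) => [->|[s sr uE]].
  (* Comparing [v] with itself shows that its distance to [b0] is less than n - 1. *)
  by rewrite dop; have := lt _ ov; have := dl_opp a_lt b0 v; lia.
by case: ou => _ nu; rewrite uE in nu *; apply/lt/noncorner_robot.
Qed.

Lemma near_le_exit P r z : side z b0 -> P r = cor z ->
  near_le (conf_of P) b0 -> near_le (conf_of (upd P r (exit z b0))) b0.
Proof.
move=> /side_neq[zb zo] rz le u ou.
have nc := exit_corner a_lt zb zo; have [db dop] := dl_exit a_lt zb zo.
case: (upd_noncorner nc ou) => [->|[s sr uE]].
  by exists (exit z b0); [exact: upd_new | rewrite db dop; lia].
case: ou => _ nu; rewrite uE in nu *.
have [v ov lev] := le _ (noncorner_robot nu); exists v => //.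
have [q qv nq] := noncorner_ofP ov; rewrite -qv; apply: upd_keeps => //.
by apply: contraNneq nq => ->; rewrite rz cor_corner.
Qed.

(** A good move lowers the distance to [b0] and raises the one to [opp b0]; if the witness itself
    moves, its new node is the witness. *)
Lemma nearer_move P r w : good b0 (P r) w -> ~~ is_corner a (P r) -> ~~ is_corner a w ->
  nearer (conf_of P) b0 -> nearer (conf_of (upd P r w)) b0.
Proof.
move=> G nr nw [v ov lt].
have [d1 _ _ _] := good_coord a_lt G; have d2 := good_dl_opp a_lt G.
have ltu u x : dl b0 x <= dl b0 v -> noncorner_of (conf_of (upd P r w)) u ->
    dl b0 x < dl (opp b0) u.
  move=> le ou; case: (upd_noncorner nw ou) => [->|[s sr uE]].
    by have := lt _ (noncorner_robot nr); lia.
  case: ou => _ nu; rewrite uE in nu *.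
  by have := lt _ (noncorner_robot nu); lia.
have [q qv nq] := noncorner_ofP ov; have [qr|qr] := eqVneq q r.
  exists w; first exact: upd_new.
  by move=> u; apply: ltu; rewrite -qv qr d1.
exists v; first by rewrite -qv; exact: upd_keeps.
by move=> u; exact: ltu.
Qed.

(** The least distance to [b0] drops by one and the least distance to [opp b0] does not drop, so a
    tie is broken. *)
Lemma near_le_closest_move P r w : good b0 (P r) w -> ~~ is_corner a w ->
  closest (conf_of P) b0 (P r) -> near_le (conf_of P) b0 ->
  nearer (conf_of (upd P r w)) b0.
Proof.
move=> G nw [nr cl] le; exists w; first exact: upd_new.
have [d1 _ _ _] := good_coord a_lt G; have d2 := good_dl_opp a_lt G.
move=> u ou; case: (upd_noncorner nw ou) => [->|[s sr uE]].
  by have [v /cl] := le _ (noncorner_robot nr); lia.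
case: ou => _ nu; rewrite uE in nu *.
by have [v /cl] := le _ (noncorner_robot nu); lia.
Qed.

Lemma started_move P Q r w : started P Q -> travelling P Q -> Q r = Some w ->
  good b0 (P r) w ->
  balanced (upd P r w) (fun r' => if r' == r then None else Q r').
Proof.
move=> [PE pend] tr Qr G.
case: (pend _ _ Qr) => [wE|[z zs rE]].
  by move: G; rewrite wE => /(good_coord a_lt)[]; lia.
have [zb zo] := side_neq zs.
have Pz y : P (R y) = cor y by rewrite PE.
have wE : w = exit z b0.
  by apply: (@good_exit _ _ a_lt _ _ _ zb zo); rewrite -Pz -rE.
have Rr y : (R y == r) = (y == z) by rewrite rE (inj_eq (R_inj a_lt p0R)).
have nce := exit_corner a_lt zb zo.
rewrite wE; split.
- by rewrite /upd Rr eq_sym (negPf zo).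
- exists z => //; rewrite /upd Rr eqxx => eE.
  by move: nce; rewrite eE cor_corner.
- move=> w'; rewrite Rr eq_sym (negPf zo) => /pend[->|[y ys /(R_inj a_lt p0R) yE]].
    by left.
  by move: ys; rewrite -yE /side eqxx andbF.
rewrite PE; have zr : p0 r = cor z by rewrite rE p0R.
case: p0_near => [near|[le occ]]; [left | right].
  exact: nearer_exit near.
split=> //.
- by move=> q nq; rewrite /upd; case: eqP nq => // ->; rewrite zr cor_corner.
- move=> y ys; rewrite /upd Rr; case: eqP => [->|_]; [by right | by left].
- exact: near_le_exit le.
move=> q w' nq; rewrite /upd in nq *; case: eqP nq => // _ nq /pend.
rewrite PE => -[|[y ys qE]]; first by left.
by rewrite qE p0R cor_corner in nq.
Qed.

Lemma balanced_move P Q r w : balanced P Q -> travelling P Q -> ~ multiple P ->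
  Q r = Some w -> good b0 (P r) w -> w != cor b0 ->
  alone (upd P r w) \/
  balanced (upd P r w) (fun r' => if r' == r then None else Q r').
Proof.
move=> [Po [z0 zs0 nz0] pendo sc] tr nm Qr G wb.
have nw : ~~ is_corner a w by case/and4P: G => _ _ _; rewrite (negPf wb).
have nwc y : w <> cor y by move=> wE; move: nw; rewrite wE cor_corner.
have missing y : P (R y) <> cor y -> upd P r w (R y) <> cor y.
  by rewrite /upd; case: eqP => // _ _; exact: nwc.
have [rc|nr] := boolP (is_corner a (P r)); last first.
  have ro : (R (opp b0) == r) = false.
    by apply/negP => /eqP rE; move: nr; rewrite -rE Po cor_corner.
  right; split.
  - by rewrite /upd ro.
  - by exists z0 => //; exact: missing.
  - move=> w'; rewrite ro => /pendo[->|all]; [by left | right].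
    by move=> y ys; apply/missing/all.
  left; case: sc => [near|[_ _ le pend _]]; first exact: nearer_move.
  case: (pend _ _ nr Qr) => [wE|cl]; last exact: near_le_closest_move.
  by move: G; rewrite wE => /(good_coord a_lt)[]; lia.
have [z rE rz] := corner_robot tr nm rc.
have Rr y : (R y == r) = (y == z) by rewrite rE (inj_eq (R_inj a_lt p0R)).
case: (side_cases b0 z) => [zE|zE|zs].
- by move: G; rewrite rz zE (negPf (good_target a_lt b0 w)).
(* The pending move of the robot opposite to the target implies that both side corners are already
   empty. *)
- left; case: (pendo w) => [|/nwc//|all]; first by rewrite -zE -rE.
  move=> y yb; case: (side_cases b0 y) => [yE|yE|ys].
  + by rewrite yE eqxx in yb.
  + by rewrite /upd Rr yE zE eqxx; exact: nwc.
  + by apply/missing/all.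
have [zb zo] := side_neq zs; right.
have wE : w = exit z b0 by apply: (@good_exit _ _ a_lt _ _ _ zb zo); rewrite -rz.
split.
- by rewrite /upd Rr eq_sym (negPf zo).
- by exists z => //; rewrite /upd Rr eqxx; exact: nwc.
- move=> w'; rewrite Rr eq_sym (negPf zo) => /pendo[->|all]; [by left | right].
  by move=> y ys; apply/missing/all.
rewrite wE; case: sc => [near|[stay sides le pend occ]]; [left | right].
  exact: nearer_exit near.
have nce := exit_corner a_lt zb zo; split=> //.
- move=> q nq; rewrite /upd; case: eqP => [qr|_]; last exact: stay.
  by move: nq; rewrite qr rE p0R cor_corner.
- move=> y ys; rewrite /upd Rr; case: eqP => [->|_]; [by right | exact: sides].
- exact: near_le_exit le.
move=> q w'; rewrite /upd; case: eqP => // /eqP qr nq /(pend _ _ nq)[|[_ cl]]; first by left.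
(* A closest robot stays closest when a second side robot comes out, because [R z0] already stands
   equally near to [b0]. *)
right; split=> // u ou; case: (upd_noncorner nce ou) => [->|[s sr uE]].
  have [d0 _] := dl_exit a_lt zb zo; have [zb0 zo0] := side_neq zs0.
  have [d1 _] := dl_exit a_lt zb0 zo0.
  have Pz0 : P (R z0) = exit z0 b0 by case: (sides z0 zs0).
  rewrite d0 -d1 -Pz0; apply/cl/noncorner_robot.
  by rewrite Pz0 exit_corner.
by case: ou => _ nu; rewrite uE in nu *; apply/cl/noncorner_robot.
Qed.

Lemma balanced_idle P Q r : balanced P Q ->
  balanced P (fun r' => if r' == r then None else Q r').
Proof.
case=> Po miss pendo sc; split=> //.
  by move=> w; case: eqP => // _; exact: pendo.
case: sc => [|[stay sides le pend occ]]; [by left | right; split=> //].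
by move=> q w nq; case: eqP => // _; exact: pend.
Qed.

Lemma sym_inv_move P Q r w : sym_inv P Q -> Q r = Some w ->
  sym_inv (fun r' => if r' == r then w else P r')
          (fun r' => if r' == r then None else Q r').
Proof.
move=> [tr st] Qr; split; first exact: travelling_move.
have [m|nm] := pselect (multiple P).
  by apply: Or41; exact: (multiple_upd a_lt tr Qr m).
have [_ pendT tgt outT] := tr.
have [wE|G] := pendT _ _ Qr.
  rewrite wE upd_same; case: st => // [al|bal|[PE pend]].
  - exact: Or42.
  - by apply: Or43; exact: balanced_idle.
  - by apply: Or44; split=> // q w'; case: eqP => // _; exact: pend.
have rb : r != R b0.
  by apply/eqP => rb; move: G; rewrite rb tgt (negPf (good_target a_lt b0 w)).
have [wb|wb] := eqVneq w (cor b0).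
  by apply: Or41; exists r => //; rewrite eqxx.
case: st => // [al|bal|st].
- apply: Or42 => z zb; case: eqP => [_ wz|_]; last exact: al.
  by move: G zb; rewrite wz => /(good_corner a_lt)->; rewrite eqxx.
- by case: (balanced_move bal tr nm Qr G wb); [apply: Or42 | apply: Or43].
- by apply: Or43; exact: (started_move st tr Qr G).
Qed.

(** In the balanced phase the two robots with a move are a closest one, which exists as a side robot
    has left its corner, and a corner robot: the other side robot if still in place, else the one
    opposite to the target. At the start they are the two side robots. *)
Lemma sym_no_deadlock P Q (z : option 'I_k) : sym_inv P Q ->
  (forall r, Some r != z -> forall w, ~ sym_rule (conf_of P) (P r) w) ->
  forall r, Some r != z -> P r = cor b0.
Proof.
move=> [tr st] dis; have [sq _ tgt outT] := tr.
have step q : P q != cor b0 -> exists w, good b0 (P q) w.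
  by move=> ne; apply: good_exists.
have [m|nm] := pselect (multiple P).
  move=> r rz; apply/eqP/negPn/negP => /step[w G].
  by apply: (dis r rz w); apply: (SymMultiple (multiple_atP tr m) G).
have stuck q r : q != r -> (exists w, sym_rule (conf_of P) (P q) w) ->
    (exists w, sym_rule (conf_of P) (P r) w) -> False.
  move=> qr [w1 en1] [w2 en2]; have [zq|zq] := eqVneq (Some q) z.
    by apply: dis en2; rewrite -zq (inj_eq Some_inj) eq_sym.
  by apply: dis en1.
have c := conf_single _ tr nm.
case: st => // [al|bal|[PE _]].
- move=> r rz; apply/eqP/negPn/negP => /step[w G].
  apply: (dis r rz w); apply: (@SymAlone _ _ _ b0) => //.
    by rewrite c tgt eqxx.
  by move=> y yb; rewrite c; case: eqP => // /al; rewrite yb => /(_ isT).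
- exfalso; have B := balanced_atP tr nm bal.
  have [Po [y ys ny] _ _] := bal; have [yb yo] := side_neq ys.
  have ny' : ~~ is_corner a (P (R y)).
    apply/negP => /(corner_robot tr nm)[x /(R_inj a_lt p0R) xE Px].
    by apply: ny; rewrite Px xE.
  case: (arg_minnP (fun q => dl b0 (P q)) (P := fun q => ~~ is_corner a (P q)) ny') => q nq qmin.
  have [w G] : exists w, good b0 (P q) w.
    by apply: step; apply: contraNneq nq => ->; exact: cor_corner.
  have enq : exists w, sym_rule (conf_of P) (P q) w.
    exists w; apply: (SymClosest B) G; split=> // u /noncorner_ofP[s <- ns].
    exact: qmin.
  have distinct x : P (R x) = cor x -> q != R x.
    by move=> Px; apply: contraNneq nq => ->; rewrite Px cor_corner.
  have enc x : x != b0 -> P (R x) = cor x -> exists w, good b0 (P (R x)) w.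
    by move=> xb Px; apply: step; rewrite Px (inj_eq (cor_inj a_lt)).
  have [Py|Py] := eqVneq (P (R (opp y))) (cor (opp y)).
    apply: (stuck _ _ (distinct _ Py)) => //.
    have ys' : side (opp y) b0 by rewrite opp_side.
    have [w' G'] := enc _ (proj1 (side_neq ys')) Py; exists w'.
    apply: (SymSide B ys' Py) G'; rewrite oppK c.
    by case: eqP ny.
  apply: (stuck _ _ (distinct _ Po)) => //.
  have [w' G'] := enc (opp b0) (negbT b0_opp) Po; exists w'.
  apply: (SymOpposite B Po) G' => x xs; rewrite c.
  case: (sideP ys xs) => ->; first by case: eqP ny.
  by rewrite (negPf Py).
exfalso.
pose y : label := (~~ b0.1, b0.2).
have ys : side y b0 by rewrite /side /y; case: b0 => [[] []].
have en x : side x b0 -> exists w, sym_rule (conf_of P) (P (R x)) w.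
  move=> xs; have [w G] : exists w, good b0 (P (R x)) w.
    by apply: step; rewrite PE p0R (inj_eq (cor_inj a_lt)); case: (side_neq xs).
  exists w; apply: (@SymInitial _ _ _ 1%g b0) => //.
  + by move=> u v; rewrite !perm1.
  + by apply/ffunP => v; rewrite PE !ffunE invg1 perm1.
  + by rewrite perm1.
  + by exists x; rewrite // PE p0R.
apply: (stuck (R y) (R (opp y))); [|exact: en|by apply: en; rewrite opp_side].
by rewrite (inj_eq (R_inj a_lt p0R)) eq_sym opp_neq.
Qed.

Lemma sym_gatherable : gatherable_1crash p0.
Proof.
apply: (@gatherable_of_relation _ _ sym_rule sym_rule_adj sym_rule_aut p0 (cor b0)
  (dl b0) sym_inv).
- exact: sym_inv0.
- exact: sym_inv_look.
- exact: sym_inv_move.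
- by move=> P Q r w [tr _]; exact: (travelling_dl a_lt tr).
- exact: sym_no_deadlock.
Qed.

End Symmetric.

(** * Symmetries of the initial configuration *)

(** For even n the half turn and the reflections in a horizontal or vertical line fix no node. *)
Lemma flip_partitive n (f : config n) c : 0 < n -> ~~ odd n -> c != (false, false) ->
  (forall v, f (dihedral false c v) = f v) -> partitive f.
Proof.
move=> n_gt0 n_even c0 fc; pose s := perm (@dihedral_inj n false c).
apply: (@involution_partitive _ _ s n_gt0).
- by apply: (@dihedral_is_aut _ false c) => v; rewrite permE.
- by move=> v; rewrite permE.
- move=> v; rewrite !permE /dihedral /=.
  by case: v => v1 v2; case: c {s fc c0} => [[] []] /=; rewrite ?rev_ordK.
- move=> v; rewrite permE; apply/eqP => /(congr1 (fun v : node n => (v.1 : nat, v.2 : nat))).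
  case=> e1 e2; move: e1 e2 c0 n_even (ltn_ord v.1) (ltn_ord v.2); rewrite !flipE; clear.
  by case: c => [[] []] //=; lia.
Qed.

Section Stabilizer.
Variables (n : nat) (f : config n).
Hypothesis n_gt0 : 0 < n.
Hypothesis n_even : ~~ odd n.
Hypothesis nonpart : ~ partitive f.

Lemma stab_value (g : {perm node n}) v : conf_map g f = f -> f (g v) = f v.
Proof. by move=> gf; rewrite -{1}gf conf_map_perm. Qed.

Lemma stab_false c : (forall v, f (dihedral false c v) = f v) -> c = (false, false).
Proof. by move=> fc; apply/eqP/negPn/negP => c0; apply: nonpart; apply: flip_partitive fc. Qed.

(** The product of two symmetries that exchange the coordinates does not exchange them, so it is
    trivial. With [c' = c] this excludes quarter turns, whose square is the half turn; in general it
    leaves a single diagonal reflection. *)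
Lemma stab_true c c' : (forall v, f (dihedral true c v) = f v) ->
  (forall v, f (dihedral true c' v) = f v) -> c'.1 = c.2 /\ c'.2 = c.1.
Proof.
move=> fc fc'.
have [] : (c'.1 (+) c.2, c'.2 (+) c.1) = (false, false).
  apply: stab_false => v; rewrite -[RHS]fc -[RHS]fc'; congr (f _).
  case: v => v1 v2; rewrite /dihedral /=.
  by case: c c' {fc fc'} => [[] []] [[] []] /=; rewrite ?rev_ordK.
by case: c c' {fc fc'} => [[] []] [[] []].
Qed.

Lemma stab_axis (g : {perm node n}) v0 : is_aut g -> conf_map g f = f -> g v0 != v0 ->
  exists e, (forall v, g v = dihedral true (e, e) v) /\
    forall h : {perm node n}, is_aut h -> conf_map h f = f ->
      (forall v, h v = v) \/ forall v, h v = dihedral true (e, e) v.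
Proof.
have n_gt1 : 1 < n by move: n_gt0 n_even; case: (n) => [|[]].
move=> ag gf gv0; have [s [c gE]] := dihedral_aut n_gt1 ag.
have fg v : f (dihedral s c v) = f v by rewrite -gE stab_value.
case: s gE fg => gE fg; last first.
  by move: gv0; rewrite gE (stab_false fg) /dihedral /=; case: (v0) => ? ?; rewrite eqxx.
have [c12 _] := stab_true fg fg.
have cE : c = (c.1, c.1) by rewrite [LHS]surjective_pairing -c12.
exists c.1; rewrite -cE; split=> // h ah hf.
have [s [d hE]] := dihedral_aut n_gt1 ah.
have fh v : f (dihedral s d v) = f v by rewrite -hE stab_value.
case: s hE fh => hE fh; [right | left] => v; rewrite hE.
  have [d1 d2] := stab_true fg fh.
  by rewrite (_ : d = c) // [LHS]surjective_pairing d1 d2 -c12 -cE.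
by rewrite (stab_false fh) /dihedral /=; case: v.
Qed.

End Stabilizer.

Lemma not_nearer_opp n (a : 'I_n) (f : config n) b :
  ~ nearer a f (opp b) -> near_le a f b.
Proof.
move=> nn u ou; apply: contrapT => nex; apply: nn; exists u => // v ov.
rewrite oppK ltnNge; apply/negP => le; apply: nex; exists v => //.
Qed.

(** * The choice of the target in the two cases *)

Section Main.
Variables (n k : nat) (p0 : 'I_k -> node n) (a : 'I_n).
Hypothesis n_even : ~~ odd n.
Hypothesis p0_inj : injective p0.
Hypothesis nonpart : ~ partitive (conf_of p0).
Hypothesis p0_sq : forall q, in_square a (p0 q).
Hypothesis corners : forall v, is_corner a v -> conf_of p0 v != ord0.
Hypothesis a_lt2 : a.*2 < n.

Let n_gt0 : 0 < n.
Proof. exact: leq_ltn_trans a_lt2. Qed.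

(** Otherwise exactly the four corners are occupied, and the half turn preserves the
    configuration. *)
Lemma noncorner_robot_exists : exists q, ~~ is_corner a (p0 q).
Proof.
apply: contrapT => none; apply: nonpart.
apply: (@flip_partitive _ _ (true, true)) => // v; apply: val_inj => /=.
have occE u : conf_of p0 u = is_corner a u :> nat.
  have [cu|nu] := boolP (is_corner a u); last first.
    rewrite conf_zero // => q qu; apply: none; exists q; by rewrite qu.
  have /conf_occP[q <-] := corners cu.
  by rewrite conf_one // => r /p0_inj.
rewrite !occE; congr nat_of_bool; rewrite /is_corner /dihedral /=.
by move: (ltn_ord v.1) (ltn_ord v.2) a_lt2; clear; lia.
Qed.

(** The side n - 2a is even, and a square of side 2 consists of its corners. *)
Lemma square_large : a.*2.+3 < n.
Proof.
have [q nq] := noncorner_robot_exists; have := p0_sq q.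
move: nq n_even a_lt2; rewrite /is_corner /in_square; clear.
by lia.
Qed.

Lemma corner_robots : exists R : label -> 'I_k, forall z, p0 (R z) = cor a z.
Proof.
have ex z : exists q, p0 q == cor a z.
  by have /corners/conf_occP[q qz] := cor_corner square_large z; exists q; apply/eqP.
by exists (fun z => xchoose (ex z)) => z; apply/eqP/(xchooseP (ex z)).
Qed.

Lemma gatherable_trivial_stab : (forall g : {perm node n}, is_aut g ->
    conf_map g (conf_of p0) = conf_of p0 -> forall v, g v = v) ->
  gatherable_1crash p0.
Proof.
move=> asym; have [R p0R] := corner_robots.
have [q nq] := noncorner_robot_exists.
pose D (x : 'I_k * label) := dl x.2 (p0 x.1).
have nq' : ~~ is_corner a (p0 (q, (false, false)).1) by [].
case: (arg_minnP D (P := fun x => ~~ is_corner a (p0 x.1)) nq') => -[rr b0] /= nrr min.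
apply: (asym_gatherable square_large n_even p0_inj p0R p0_sq nrr _ asym (b0 := b0)).
by move=> s z ns; exact: (min (s, z)).
Qed.

Lemma gatherable_diagonal (g : {perm node n}) v0 : is_aut g ->
  conf_map g (conf_of p0) = conf_of p0 -> g v0 != v0 -> gatherable_1crash p0.
Proof.
move=> ag gf gv0; have [R p0R] := corner_robots; have a_lt := square_large.
have [e [gE stabE]] := stab_axis n_gt0 n_even nonpart ag gf gv0.
(* An end of the axis: the reflection given by [(e, e)] fixes this label and its opposite. *)
pose b : label := (e, false).
have fixb c : c = b \/ c = opp b -> forall h : {perm node n}, is_aut h ->
    conf_map h (conf_of p0) = conf_of p0 -> h (cor a c) = cor a c.
  move=> cb h ah hf; case: (stabE h ah hf) => -> //.
  rewrite /cor dihedral_at.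
  by case: cb => ->; rewrite /b /opp; case: (e).
(* The reflection exchanges the side corners, so their exits are occupied alike and one side corner
   [y] decides for both. *)
have exitE z c : c = b \/ c = opp b -> side z c ->
    (exists q, p0 q = exit a_lt (opp z) c) <-> (exists q, p0 q = exit a_lt z c).
  move=> cb zc; have <- : g (exit a_lt z c) = exit a_lt (opp z) c.
    rewrite gE /exit dihedral_at; move: zc.
    by case: cb => ->; rewrite /b /side /opp; case: (e) z => [] [[] []].
  split=> /conf_occP occ; apply/conf_occP; by rewrite ?stab_value // in occ *.
suff [c cb near] : exists2 c, c = b \/ c = opp b &
    nearer a (conf_of p0) c \/ near_le a (conf_of p0) c /\
    forall z, side z c -> (exists q, p0 q = exit a_lt z (opp c)) ->
      exists q, p0 q = exit a_lt z c.
  exact: (sym_gatherable p0_inj p0R p0_sq (fixb c cb) near).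
have [near|nb] := pselect (nearer a (conf_of p0) b).
  by exists b; left.
have [near|no] := pselect (nearer a (conf_of p0) (opp b)).
  by exists (opp b); [right | left].
have le_b := not_nearer_opp no.
have le_o : near_le a (conf_of p0) (opp b) by apply: not_nearer_opp; rewrite oppK.
pose y : label := (~~ e, false).
have ys : side y b by rewrite /side /y /b; case: (e).
have all_sides c : c = b \/ c = opp b ->
    ((exists q, p0 q = exit a_lt y (opp c)) -> exists q, p0 q = exit a_lt y c) ->
    forall z, side z c -> (exists q, p0 q = exit a_lt z (opp c)) ->
      exists q, p0 q = exit a_lt z c.
  move=> cb yE z zc.
  have yc : side y c by case: cb => ->; rewrite ?side_opp.
  have ocb : opp c = b \/ opp c = opp b by case: cb => ->; rewrite ?oppK; [right | left].
  case: (sideP yc zc) => -> //.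
  by move/(exitE _ _ ocb); rewrite side_opp => /(_ yc)/yE/(exitE _ _ cb yc).
(* In a tie, at least one of the two implications between the exits of [cor y] holds, and it
   determines the end to choose. *)
have [E|nE] := pselect ((exists q, p0 q = exit a_lt y (opp b)) -> exists q, p0 q = exit a_lt y b).
  by exists b; [left | right; split=> //; apply: all_sides => //; left].
exists (opp b); [by right | right; split=> //].
apply: all_sides; [by right|rewrite oppK => E].
by apply: contrapT => nE'; apply: nE.
Qed.

End Main.

Theorem theorem10 (n k : nat) (p0 : 'I_k -> node n) :
  ~~ odd n -> 3 <= k -> injective p0 ->
  ~ partitive (conf_of p0) ->
  mes_corners_occupied (conf_of p0) ->
  gatherable_1crash p0.
Proof.
move=> n_even k3 p0_inj nonpart corners.
have n_gt0 : 0 < n.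
  by case: n p0 {n_even p0_inj nonpart corners} => // p0; case: (p0 (Ordinal (ltnW (ltnW k3)))) => [[]].
(* The whole grid encloses, so the maximum defining [mes_offset] is attained, by [a] below. *)
have enc0 : encloses (conf_of p0) (Ordinal n_gt0).
  rewrite /encloses /= n_gt0; apply/forallP => v; apply/implyP => _.
  rewrite /in_square /= subn0.
  by apply/andP; split; rewrite -ltnS prednK ?ltn_ord.
have [|a enca aE] := @eq_bigmax_cond _ (fun i : 'I_n => encloses (conf_of p0) i) (@nat_of_ord n).
  by apply/card_gt0P; exists (Ordinal n_gt0).
have {}corners v : is_corner a v -> conf_of p0 v != ord0.
  by move=> ca; apply: corners; rewrite /mes_offset aE.
have [a_lt2 /forallP sq] := andP enca.
have p0_sq q : in_square a (p0 q) by apply: (implyP (sq _)); exact: conf_occ.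
have [asym|/existsNP[g /not_implyP[ag /not_implyP[gf /existsNP[v /eqP gv]]]]] :=
  pselect (forall g : {perm node n}, is_aut g ->
    conf_map g (conf_of p0) = conf_of p0 -> forall v, g v = v).
  exact: (gatherable_trivial_stab n_even p0_inj nonpart p0_sq corners a_lt2).
exact: (gatherable_diagonal n_even p0_inj nonpart p0_sq corners a_lt2 ag gf gv).
Qed.
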